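(* Let $\mathbf p=(p_1,\dots,p_n)$ be a probability vector, let $[0,1)$ denote the circle group (addition modulo $1$) with Lebesgue measure $\nu$, and let $g_1,\dots,g_n\in[0,1)$. Let $B=\{1,\dots,n\}^{\mathbf N^*}$ with product measure $\mu$ giving symbol $j$ weight $p_j$, let $\sigma$ be the shift on $B$, let $\lambda=\mu\times\nu$, and define $S$ on $B\times[0,1)$ by $S(x,g)=(\sigma x,\,g+g_j \bmod 1)$ if $x_0=j$. Then the $\mathbf p$-endomorphism $(B\times[0,1),\lambda,S)$ is tvwB if and only if there exist $i\ne j$ with $p_i=p_j$ such that $g_j-g_i$ is irrational.
   Context: **Conventions.** $\mathbf N^*=\{0,1,2,\dots\}$; $(\sigma x)_j=x_{j+1}$. All components of $\mathbf p$ are positive. The circle $[0,1)=\mathbf R/\mathbf Z$ carries its usual compact group topology. **Measure-preserving systems.** A measure-preserving system (m.p.s.) is a quadruple $(X,\mathcal B,\mu,T)$ where $X$ is a compact metric space with Borel $\sigma$-algebra $\mathcal B$, $(X,\mathcal B,\mu)$ is a nonatomic Lebesgue probability space (isomorphic to $[0,1]$ with Lebesgue measure), and $T:X\to X$ is measurable with $\mu(T^{-1}B)=\mu(B)$ for $B\in\mathcal B$. **$\mathbf p$-endomorphisms.** For $\mathbf p=(p_1,\dots,p_n)$ let $h(\mathbf p)=-\sum_j p_j\log_2 p_j$. An m.p.s. $(X,\mathcal B,\mu,T)$ is a $\mathbf p$-endomorphism if $T$ is $n$-to-1 a.e., for a.a. $x$ the conditional probabilities (given $x$) of the $n$ preimages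 of $x$ under $T$ are the components of $\mathbf p$ (with multiplicity), and its entropy is $h(\mathbf p)$. **Trees.** $\mathcal T$ is the set of all finite sequences (nodes) of elements of $\{1,\dots,n\}$, including the empty one; $|v|$ is the length of $v$; $\mathcal T'$ is the set of nonempty nodes; $\mathcal T_N=\{v:|v|\le N\}$, $\mathcal T_N'=\{v:0<|v|\le N\}$. $\varsigma:\mathcal T'\to\mathcal T$ deletes the leftmost symbol. The weight of $v=(a_1,\dots,a_j)$ is $w_v=\prod_i p_{a_i}$ (and $1$ for the empty node). A tree automorphism is a bijection $A:\mathcal T\to\mathcal T$ with $A\varsigma(v)=\varsigma A(v)$ and $w_{Av}=w_v$ for all $v\in\mathcal T'$; $\mathcal A_N$ is the set of restrictions of tree automorphisms to $\mathcal T_N$. For a compact metric space $(R,d)$ and functions $h,h'$ into $R$ defined on $\mathcal T_N'$ (or on $\mathcal T'$), $$\bar t_N(h,h')=\frac1N\inf_{A\in\mathcal A_N}\sum_{0<|v|\le N}w_v\,d(h(v),h'(Av)).$$ **Tree names.** A tree partition of a $\mathbf p$-endomorphism $(X,\mathcal B,\mu,T)$ is a measurable $K:X\to\{1,\dots,n\}$ such that for a.a. $x$ the $n$ preimages of $x$ have distinct $K$-values and the preimage with $K$-value $j$ has conditional probability $p_j$. Fix one. For $j\in\{1,\dots,n\}$, $T_jx$ is the preimage of $x$ with $K$-value $j$; for $v=(a_1,\dots,a_m)$, $T_vx=T_{a_1}(T_{a_2}\cdots(T_{a_m}x)\cdots)$. For $g:X\to R$ the $g$-tree name of $x$ is $\tau_x^g:\mathcal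 T'\to R$, $\tau_x^g(v)=g(T_vx)$. **tvwB.** For a $\mathbf p$-endomorphism $\mathbf X$ and a measurable $g:X\to R$ into a compact metric space, $(\mathbf X,g)$ is tvwB (tree very weak Bernoulli) if for every $\varepsilon>0$ there is $N$ such that for every $m\ge N$ there is a set $H\subseteq X$ of measure at least $1-\varepsilon$ with $\bar t_m(\tau_x^g,\tau_y^g)<\varepsilon$ for all $x,y\in H$ (independent of the choice of $K$). $\mathbf X$ is tvwB if $(\mathbf X,g)$ is tvwB for every compact metric space $R$ and every measurable $g:X\to R$. *)

(* Defs.v *)
From HB Require Import structures.
From mathcomp Require Import all_boot all_order all_algebra.
From mathcomp Require Import all_classical all_reals all_analysis.

Set Implicit Arguments.
Unset Strict Implicit.
Unset Printing Implicit Defensive.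

Import Order.TTheory GRing.Theory Num.Theory.
Import numFieldNormedType.Exports.

Local Open Scope classical_set_scope.
Local Open Scope ring_scope.

(* The alphabet has n.+1 symbols, 'I_n.+1: a probability vector has at least one
   component, and measurable types must be inhabited. *)

Section trees.
Context {R : realType} {n : nat}.
Implicit Types (p : 'I_n.+1 -> R) (v : seq 'I_n.+1) (M : metricType R).

Definition positive_prob_vector p : Prop :=
  (forall j, 0 < p j) /\ \sum_j p j = 1.

Definition weight p v : R := \prod_(a <- v) p a.

(* Deleting the leftmost symbol is behead.  Its value on the empty node is not
   constrained, since only v != [::] occurs below and this forces A v != [::]:
   otherwise A (behead v) = [::] = A v, against injectivity. *)
Definition tree_automorphism p (A : seq 'I_n.+1 -> seq 'I_n.+1) : Prop :=
  bijective A /\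
  (forall v, v != [::] ->
     A (behead v) = behead (A v) /\ weight p (A v) = weight p v).

(* The infimum over restrictions of automorphisms to the nodes of length at
   most N is taken over the automorphisms themselves: they preserve length, so
   the sum only depends on the restriction. *)
Definition tbar p M (N : nat) (h h' : seq 'I_n.+1 -> M) : R :=
  N%:R^-1 *
  inf [set \sum_(1 <= k < N.+1) \sum_(v : k.-tuple 'I_n.+1)
             weight p v * mdist (h v) (h' (A v))
      | A in [set A | tree_automorphism p A]].

End trees.

Section systems.
Context {R : realType} {n : nat} {d : measure_display} {X : measurableType d}.
Implicit Types (p : 'I_n.+1 -> R) (mu : probability X R) (T : X -> X).
Implicit Types (K : X -> 'I_n.+1) (M : metricType R).

Definition measure_preserving mu T : Prop :=
  measurable_fun setT T /\
  (forall B, measurable B -> mu (T @^-1` B) = mu B).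

(* c x is a version of mu (E | T = x), the conditional probability given x of
   the part of the fibre of T over x that lies in E.  As T preserves mu, the
   law of T against which c is integrated is mu. *)
Definition is_fiber_prob mu T (E : set X) (c : X -> R) : Prop :=
  measurable_fun setT c /\
  (forall B, measurable B ->
     mu (E `&` T @^-1` B) = (\int[mu]_(x in B) (c x)%:E)%E).

(* As K takes all its values in 'I_n.+1, the second clause says that almost
   every x has exactly as many preimages as there are symbols, with pairwise
   distinct K-values. *)
Definition tree_partition p mu T K : Prop :=
  [/\ forall j, measurable (K @^-1` [set j]),
      {ae mu, forall x, forall j, exists! y, T y = x /\ K y = j} &
      forall j, is_fiber_prob mu T (K @^-1` [set j]) (cst (p j))].

(* On the null set of x with no preimage of K-value j, or several, the value
   (x itself, or an arbitrary candidate) is irrelevant. *)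
Definition preimage_branch T K (j : 'I_n.+1) (x : X) : X :=
  xget x [set y | T y = x /\ K y = j].

Definition node_branch T K (v : seq 'I_n.+1) (x : X) : X :=
  foldr (preimage_branch T K) x v.

Definition tree_name T K M (g : X -> M) (x : X) : seq 'I_n.+1 -> M :=
  fun v => g (node_branch T K v x).

Definition borel_measurable M (g : X -> M) : Prop :=
  forall U : set M, open U -> measurable (g @^-1` U).

Definition tvwB_fun p mu T K M (g : X -> M) : Prop :=
  forall e : R, 0 < e ->
  exists N : nat, forall m : nat, (N <= m)%N ->
  exists H : set X,
    [/\ measurable H, ((1 - e)%:E <= mu H)%E &
        forall x y, H x -> H y ->
          tbar p m (tree_name T K g x) (tree_name T K g y) < e].

(* Any choice of the tree partition K gives the same property: by uniqueness of
   fibre probabilities, changing K permutes, at almost every x, the branches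
   T_j x among symbols of equal weight, and tbar is invariant under this. *)
Definition tvwB p mu T : Prop :=
  measure_preserving mu T /\
  exists K, tree_partition p mu T K /\
    forall M (g : X -> M),
      compact [set: M] -> borel_measurable g -> tvwB_fun p mu T K g.

End systems.

HB.instance Definition _ (n : nat) := isPointed.Build 'I_n.+1 ord0.

Definition coordinate_sets (n : nat) : set (set (nat -> 'I_n.+1)) :=
  [set A | exists k j, A = [set x | x k = j]].

Definition seqspace (n : nat) := g_sigma_algebraType (@coordinate_sets n).

(* Finite-dimensional cylinders form a pi-system generating the sigma-algebra,
   so this determines mu. *)
Definition is_product_measure (R : realType) (n : nat) (p : 'I_n.+1 -> R)
    (mu : probability (seqspace n) R) : Prop :=
  forall (m : nat) (a : nat -> 'I_n.+1),
    mu [set x : seqspace n | forall k, (k < m)%N -> x k = a k] =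
    (\prod_(k < m) p (a k))%:E.

Section circle.
Context {R : realType}.

Definition unit_arc : Type := {x : R | 0 <= x < 1}.

HB.instance Definition _ := Choice.on unit_arc.

Lemma unit_arc0 : 0 <= (0 : R) < 1.
Proof. by rewrite lexx ltr01. Qed.

HB.instance Definition _ := isPointed.Build unit_arc (exist _ 0 unit_arc0).

Definition unit_arc_val (u : unit_arc) : measurableTypeR R := sval u.

(* The trace on [0, 1) of the Borel sigma-algebra of the line, which is the
   Borel sigma-algebra of the circle. *)
Definition circle := g_sigma_algebra_preimageType unit_arc_val.

Definition circle_val (u : circle) : R := sval u.

Lemma frac_itv (x : R) : 0 <= x - (Num.floor x)%:~R < 1.
Proof.
by rewrite subr_ge0 Num.Theory.floor_le ltrBlDl -intrD1 floorD1_gt.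
Qed.

Definition circle_frac (x : R) : circle :=
  exist _ (x - (Num.floor x)%:~R) (frac_itv x).

Definition circle_add (u v : circle) : circle :=
  circle_frac (circle_val u + circle_val v).

Definition circle_lebesgue (A : set circle) : \bar R :=
  lebesgue_measure (circle_val @` A).


Lemma circle_val_inj : injective circle_val.
Proof. by move=> u v; exact: val_inj. Qed.

Lemma image_circle_val (B : set (measurableTypeR R)) :
  circle_val @` (circle_val @^-1` B) = B `&` `[0, 1[%classic.
Proof.
apply/seteqP; split=> [_ [u Bu <-]|x [Bx]].
  by split=> //=; rewrite in_itv/=; exact: (svalP u).
by rewrite /= in_itv/= => x01; exists (exist _ x x01).
Qed.

Lemma measurable_image_circle_val (A : set circle) : measurable A ->
  measurable (circle_val @` A : set (measurableTypeR R)).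
Proof.
move=> [B mB <-]; rewrite setTI [X in measurable X]image_circle_val.
by apply: measurableI => //; exact: measurable_itv.
Qed.

Let circle_lebesgue0 : circle_lebesgue set0 = 0%E.
Proof. by rewrite /circle_lebesgue image_set0 measure0. Qed.

Let circle_lebesgue_ge0 A : (0 <= circle_lebesgue A)%E.
Proof. exact: measure_ge0. Qed.

Let circle_lebesgue_sigma_additive : semi_sigma_additive circle_lebesgue.
Proof.
move=> F mF tF mUF; rewrite /circle_lebesgue image_bigcup.
apply: measure_semi_sigma_additive.
- by move=> k; exact: measurable_image_circle_val.
- move=> i j _ _ [_ [[u Fu <-] [v Fv /circle_val_inj vu]]].
  by apply: tF => //; exists u; split; [exact: Fu | rewrite -vu].
- by apply: bigcup_measurable => k _; exact: measurable_image_circle_val.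
Qed.

HB.instance Definition _ := isMeasure.Build _ circle R circle_lebesgue
  circle_lebesgue0 circle_lebesgue_ge0 circle_lebesgue_sigma_additive.

Let circle_lebesgue_setT : circle_lebesgue [set: circle] = 1%E.
Proof.
rewrite /circle_lebesgue -(preimage_setT circle_val) image_circle_val setTI.
by rewrite lebesgue_measure_itv/= lte_fin ltr01 oppr0 adde0.
Qed.

HB.instance Definition _ := Measure_isProbability.Build _ circle R
  circle_lebesgue circle_lebesgue_setT.

End circle.
Arguments circle R : clear implicits.
Arguments circle_lebesgue R A : clear implicits.

Definition skew_shift (R : realType) (n : nat) (g : 'I_n.+1 -> circle R)
    (z : seqspace n * circle R) : seqspace n * circle R :=
  ((fun k => z.1 k.+1) : seqspace n, circle_add z.2 (g (z.1 0%N))).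

(* Main.v *)
(* A preimage T_v (x, u) has first coordinate v followed by x and second
   coordinate u minus the sum of the g_a, a in v.

   If g_j - g_i is irrational with p_i = p_j, two names at angles u and u' are
   matched by the automorphism that exchanges the symbols i and j at every node
   until the two angles are close, and is the identity from then on.  Along a
   random branch the difference of the angles performs a lazy random walk with
   steps +- (g_j - g_i), which comes close to 0 within a time that is uniform in
   the starting point.  Afterwards the two branches carry the same symbols and
   stay at the same small angle, so that a function which is uniformly
   continuous outside a set of small measure takes close values at most nodes.

   Otherwise some q > 0 turns all differences g_j - g_i with p_i = p_j into
   integers.  An automorphism then changes the angle of a node by a multiple of
   1/q only, so for the two-valued function [frac (q u) < 1/2] the names of
   (x, u) and (x, u + 1/(2q)) differ at every node, whatever the automorphism. *)

From HB Require Import structures.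
Require Import Defs.
From mathcomp Require Import all_boot all_order all_algebra.
From mathcomp Require Import perm.
From mathcomp Require Import all_classical all_reals all_analysis.
From mathcomp Require Import measurable_realfun.
From mathcomp Require Import ring lra zify.

Set Implicit Arguments.
Unset Strict Implicit.
Unset Printing Implicit Defensive.

Import Order.TTheory GRing.Theory Num.Theory.
Import numFieldNormedType.Exports.

Local Open Scope classical_set_scope.
Local Open Scope ring_scope.

(** * Weighted sums over the levels of the tree *)

Section level_sums.
Context {R : realType} {n : nat} (p : 'I_n.+1 -> R) (hp : positive_prob_vector p).
Implicit Types (F G : seq 'I_n.+1 -> R) (v w : seq 'I_n.+1).

Lemma weight_cons a v : weight p (a :: v) = p a * weight p v.
Proof. by rewrite /weight big_cons. Qed.

Lemma weight_gt0 v : 0 < weight p v.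
Proof. by apply: prodr_gt0 => a _; exact: hp.1. Qed.

(** The expectation of [F] at a random node of length [k] whose symbols are independent with law
    [p]. *)
Definition level_sum k F : R := \sum_(v : k.-tuple 'I_n.+1) weight p v * F v.

Lemma level_sum0 F : level_sum 0 F = F [::].
Proof.
rewrite /level_sum (big_pred1 [tuple]); last by move=> v; apply/esym/eqP; exact: tuple0.
by rewrite /weight big_nil mul1r.
Qed.

Lemma level_sumS k F :
  level_sum k.+1 F = level_sum k (fun v => \sum_a p a * F (a :: v)).
Proof.
rewrite /level_sum (reindex (fun av : 'I_n.+1 * k.-tuple 'I_n.+1 =>
  cons_tuple av.1 av.2)) /=; last first.
  exists (fun v : k.+1.-tuple 'I_n.+1 => (thead v, behead_tuple v)).
    by move=> [a v] _; rewrite /= theadE; congr pair; apply: val_inj.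
  by move=> v _; apply: val_inj; case/tupleP: v => a v.
rewrite -(pair_bigA _ (fun a (v : k.-tuple 'I_n.+1) =>
   weight p (a :: v) * F (a :: v))) exchange_big /=.
apply: eq_bigr => v _; rewrite mulr_sumr; apply: eq_bigr => a _.
by rewrite weight_cons; ring.
Qed.

Lemma eq_level_sum k F G : (forall v, size v = k -> F v = G v) ->
  level_sum k F = level_sum k G.
Proof. by move=> FG; apply: eq_bigr => v _; rewrite FG// size_tuple. Qed.

Lemma le_level_sum k F G : (forall v, size v = k -> F v <= G v) ->
  level_sum k F <= level_sum k G.
Proof.
move=> FG; apply: ler_sum => v _.
by rewrite ler_wpM2l ?FG ?size_tuple// ltW// weight_gt0.
Qed.

Lemma level_sum_cst k c : level_sum k (fun=> c) = c.
Proof.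
elim: k => [|k IH]; first by rewrite level_sum0.
rewrite level_sumS -[RHS]IH; apply: eq_level_sum => v _.
by rewrite -mulr_suml hp.2 mul1r.
Qed.

Lemma level_sumD k F G :
  level_sum k (fun v => F v + G v) = level_sum k F + level_sum k G.
Proof.
by rewrite /level_sum -big_split /=; apply: eq_bigr => v _; rewrite mulrDr.
Qed.

Lemma level_sumZ k c F :
  level_sum k (fun v => c * F v) = c * level_sum k F.
Proof. by rewrite /level_sum mulr_sumr; apply: eq_bigr => v _; ring. Qed.

(** Nodes grow on the left, so the suffix [w] is the part nearest the root: the inner sum is an
    expectation conditional on the first [l] generations. *)
Lemma level_sum_cat k l F :
  level_sum (k + l) F = level_sum l (fun w => level_sum k (fun v => F (v ++ w))).
Proof.
elim: k F => [|k IH] F.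
  by apply: eq_level_sum => w _; rewrite level_sum0.
rewrite addSn level_sumS IH; apply: eq_level_sum => w _.
by rewrite level_sumS.
Qed.

Variable s : seq 'I_n.+1 -> 'I_n.+1 -> 'I_n.+1.

(* The new name of the leftmost symbol may depend on the rest of the node, as
   children are formed by adding a symbol on the left. *)
Fixpoint relabel v := if v is a :: w then s w a :: relabel w else [::].

(** The inverse of [relabel] for involutions [s w]: the rest of the node is recovered first, because
    it decides which involution was applied to the leftmost symbol. *)
Fixpoint unrelabel v :=
  if v is a :: w then s (unrelabel w) a :: unrelabel w else [::].

Lemma size_relabel v : size (relabel v) = size v.
Proof. by elim: v => //= a v ->. Qed.

Hypothesis (sK : forall v, involutive (s v)).
Hypothesis (ps : forall v a, p (s v a) = p a).

Lemma relabel_automorphism : tree_automorphism p relabel.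
Proof.
split; first exists unrelabel.
- by elim=> //= a v ->; rewrite sK.
- by elim=> //= a v ->; rewrite sK.
case=> // a v _; split => //.
by elim: {a v}(a :: v) => // a v /= IH; rewrite !weight_cons ps IH.
Qed.

(** At each node the children are permuted among equal weights, so the law of a random node is
    invariant. *)
Lemma level_sum_relabel k F :
  level_sum k (fun v => F (relabel v)) = level_sum k F.
Proof.
elim: k F => [|k IH] F; first by rewrite !level_sum0.
rewrite !level_sumS -[RHS]IH; apply: eq_level_sum => v _ /=.
rewrite [RHS](reindex_inj (inv_inj (sK v))); apply: eq_bigr => a _.
by rewrite ps.
Qed.

End level_sums.

(** * Coupling two names by a random walk *)

Section near_integer.
Context {R : realType}.
Implicit Types (d t a : R).

(** Closeness to 0 on the circle, stated for real representatives so that angles are added without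
    reduction modulo 1. It is a boolean because the coupling branches on it. *)
Definition near_integer d t : bool := `[< exists k : int, `|t - k%:~R| < d >].

Lemma near_integerD d t (k : int) :
  near_integer d (t + k%:~R) = near_integer d t.
Proof.
apply/asboolP/asboolP => -[l H].
  by exists (l - k); rewrite intrB opprB addrA.
by exists (l + k); rewrite intrD opprD addrACA subrr addr0.
Qed.

(** Dirichlet's pigeonhole: among [N.+2] fractional parts two share one of [N.+1] boxes of length
    less than [d]; irrationality makes their difference nonzero. *)
Lemma irrational_small_multiple a d : irrational a -> 0 < d ->
  exists (s : nat) (l : int), 0 < `|s%:R * a - l%:~R| < d.
Proof.
move=> a_irr d0.
have [N Nd] : exists N : nat, d^-1 < N.+1%:R.
  by exists (Num.truncn d^-1); rewrite truncnS_gt.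
pose f (k : nat) := k%:R * a - (Num.floor (k%:R * a))%:~R.
have f01 k : 0 <= f k < 1 by exact: frac_itv.
pose h (k : 'I_N.+2) : 'I_N.+1 := inord (Num.truncn (N.+1%:R * f k)).
have hE k : (h k)%:R <= N.+1%:R * f k < (h k).+1%:R.
  rewrite /h inordK; last first.
    rewrite truncn_lt_nat; last by rewrite mulr_ge0//; case/andP: (f01 k).
    by rewrite gtr_pMr// ; case/andP: (f01 k).
  rewrite truncnS_gt andbT truncn_le// mulr_ge0//.
  by case/andP: (f01 k).
have /injectivePn[k [l /= kl hkl]] : ~~ injectiveb h.
  by apply/injectiveP => /leq_card; rewrite !card_ord ltnn.
wlog lk : k l kl hkl / (l < k)%N.
  move=> W; have [|kl'|/val_inj E] := ltngtP l k; first exact: W.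
    by apply: (W l k) => //; rewrite eq_sym.
  by rewrite E eqxx in kl.
exists (k - l)%N, (Num.floor (k%:R * a) - Num.floor (l%:R * a)).
have E : (k - l)%:R * a - (Num.floor (k%:R * a) - Num.floor (l%:R * a))%:~R
    = f k - f l by rewrite natrB 1?ltnW// intrB /f; ring.
rewrite E normr_gt0; apply/andP; split.
  apply/eqP => H; apply: a_irr; apply/rationalP.
  exists (Num.floor (k%:R * a) - Num.floor (l%:R * a)), (k - l)%N.
  have kl0 : (k - l)%:R != 0 :> R by rewrite pnatr_eq0 subn_eq0 -ltnNge.
  by move/eqP: E; rewrite H subr_eq0 => /eqP <-; field.
have H : `|N.+1%:R * f k - N.+1%:R * f l| < 1.
  have := hE k; have := hE l; rewrite hkl ltr_norml -(natr1 (h l)).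
  by move: (_ * f k) (_ * f l) (_%:R) => x y z; lra.
have N0 : 0 < N.+1%:R :> R by [].
rewrite -mulrBr normrM gtr0_norm// in H.
have : `|f k - f l| < N.+1%:R^-1 by rewrite -ltr_pdivlMl ?mulr1// in H.
move/lt_trans; apply; rewrite invf_plt//.
Qed.

(** Modulo 1 some multiple of [a] is a nonzero [b] shorter than [d]. Steps of length [b] go round
    the circle in about [1/|b|] moves, a bound that does not depend on the target [t]. *)
Lemma irrational_multiples_dense a d : irrational a -> 0 < d ->
  exists L : nat, forall t, exists2 k, (k <= L)%N & near_integer d (t - k%:R * a).
Proof.
move=> a_irr d0.
have [s [l]] := irrational_small_multiple a_irr d0.
set b := _ - _ => /andP[b0 bd].
have bn0 : b != 0 by rewrite -normr_gt0.
pose M := (Num.truncn `|b|^-1).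
exists (M * s)%N => t.
pose f := t - (Num.floor t)%:~R.
have /andP[f0 f1] : 0 <= f < 1 by exact: frac_itv.
(* The representative of [t] modulo 1 on the side of 0 towards which the multiples of [b] move. *)
pose y := if 0 < b then f else f - 1.
have [c yE] : exists c : int, y = t - c%:~R.
  rewrite /y /f; case: ifP => _; first by exists (Num.floor t).
  by exists (Num.floor t + 1); rewrite intrD; ring.
have yb : 0 <= y / b <= `|b|^-1.
  rewrite /y; case: ifPn => [b_gt0|].
    rewrite gtr0_norm// divr_ge0 1?(ltW b_gt0)//= -[leRHS]mul1r.
    by apply: ler_wpM2r; rewrite ?invr_ge0 ltW.
  rewrite -leNgt le_eqVlt (negbTE bn0) /= => b_lt0.
  have -> : (f - 1) / b = (1 - f) / - b by field.
  rewrite ltr0_norm// divr_ge0 ?subr_ge0 ?oppr_ge0 1?(ltW f1) 1?(ltW b_lt0)//=.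
  rewrite -[leRHS]mul1r; apply: ler_wpM2r; last lra.
  by rewrite invr_ge0 oppr_ge0 ltW.
have /andP[yb0 yb1] := yb.
exists (Num.truncn (y / b) * s)%N.
  by rewrite leq_mul2r le_truncn ?orbT.
apply/asboolP; set k := Num.truncn _.
exists (c - k%:Z * l).
have -> : t - (k * s)%:R * a - (c - k%:Z * l)%:~R = (y / b - k%:R) * b.
  rewrite mulrBl divfK// yE intrB intrM natrM /b -pmulrn; ring.
have /andP[k1 k2] := truncn_itv yb0.
rewrite normrM ger0_norm ?subr_ge0//.
apply: le_lt_trans bd; rewrite ler_piMl//.
by rewrite lerBlDr addrC natr1 ltW.
Qed.

End near_integer.

(** * The stopped random walk of angle differences *)

Section coupling.
Context {R : realType} {n : nat} (p : 'I_n.+1 -> R) (hp : positive_prob_vector p).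
Variables (gam : 'I_n.+1 -> R) (i j : 'I_n.+1) (d : R).
Hypothesis pij : p i = p j.
Implicit Types (v w : seq 'I_n.+1) (t : R).

(* Difference of the angles above coupling t v and v when it is t at the root. *)
Fixpoint walk t v : R :=
  if v is a :: w then
    let t' := walk t w in
    if near_integer d t' then t' else t' - (gam (tperm i j a) - gam a)
  else t.

Definition coupling_rule t w a :=
  if near_integer d (walk t w) then a else tperm i j a.

Definition coupling t := relabel (coupling_rule t).

Lemma coupling_ruleK t w : involutive (coupling_rule t w).
Proof. by rewrite /coupling_rule => a; case: near_integer => //; exact: tpermK. Qed.

Lemma coupling_rule_prob t w a : p (coupling_rule t w a) = p a.
Proof. by rewrite /coupling_rule; case: ifP => // _; case: tpermP => // ->. Qed.

(** The telescoped form, which identifies the walk with the difference of the angles reached along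
    the two matched nodes. *)
Lemma walkE t v :
  walk t v = t - \sum_(a <- coupling t v) gam a + \sum_(a <- v) gam a.
Proof.
elim: v => [|a v IH] /=; first by rewrite !big_nil subr0 addr0.
rewrite !big_cons /coupling_rule -/(coupling t v); case: ifP => _; rewrite IH; ring.
Qed.

Lemma walk_cat t v w : walk t (v ++ w) = walk (walk t w) v.
Proof. by elim: v => //= a v ->. Qed.

Lemma walk_near t v : near_integer d t -> walk t v = t.
Proof. by move=> td; elim: v => //= a v ->; rewrite td. Qed.

Lemma coupling_cat_near t v w : near_integer d (walk t w) ->
  coupling t (v ++ w) = v ++ coupling t w.
Proof.
move=> td; elim: v => //= a v; rewrite -/(coupling _ _) => ->.
by rewrite /coupling_rule walk_cat walk_near// td.
Qed.

(** As the walk stops once it is near an integer, this is the probability that it has not been near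
    one up to time [k]. *)
Definition miss k t := level_sum p k (fun v => (~~ near_integer d (walk t v))%:R).

Lemma missD k l t : miss (k + l) t = level_sum p l (fun w => miss k (walk t w)).
Proof.
rewrite /miss level_sum_cat; apply: eq_level_sum => w _.
by apply: eq_level_sum => v _; rewrite walk_cat.
Qed.

Lemma miss_near k t : near_integer d t -> miss k t = 0.
Proof.
move=> td; rewrite -[RHS](level_sum_cst hp k); apply: eq_level_sum => v _.
by rewrite walk_near// td.
Qed.

Lemma miss_ge0 k t : 0 <= miss k t.
Proof. by rewrite -(level_sum_cst hp k 0); exact: le_level_sum. Qed.

(* Markov property: once near 0 the walk stays there. *)
Lemma missD_le k l t c : (forall u, miss k u <= c) -> miss (k + l) t <= c * miss l t.
Proof.
move=> kc; rewrite missD -level_sumZ; apply: le_level_sum => // w _.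
have [wn|wn] := boolP (near_integer d (walk t w)); last by rewrite mulr1 kc.
by rewrite mulr0 miss_near.
Qed.

(** Along the constant branch [i, i, ...] the walk makes equal steps, and so runs through the
    multiples of [gam j - gam i] until it stops. *)
Lemma walk_nseq t k : near_integer d (walk t (nseq k i)) \/
  walk t (nseq k i) = t - k%:R * (gam j - gam i).
Proof.
elim: k => [|k IH]; first by right; rewrite mul0r subr0.
rewrite /=; case: ifP => [|kn]; first by left.
right; case: IH => [|->]; first by rewrite kn.
by rewrite tpermL -natr1; ring.
Qed.

Lemma walk_nseq_near t k l : (k <= l)%N -> near_integer d (walk t (nseq k i)) ->
  near_integer d (walk t (nseq l i)).
Proof. by move=> /subnK <- kn; rewrite nseqD walk_cat walk_near. Qed.

(** From any starting point the word made of [L] symbols [i] stops the walk. A block of [L] steps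
    therefore fails with probability at most [c < 1], and [r] successive blocks with probability at
    most [c ^+ r]. *)
Lemma miss_uniformly_small e : irrational (gam j - gam i) -> 0 < d -> 0 < e ->
  exists N, forall k t, (N <= k)%N -> miss k t <= e.
Proof.
move=> girr d0 e0.
have [L HL] := irrational_multiples_dense girr d0.
pose c := 1 - weight p (nseq L i).
have c1 : c < 1 by rewrite /c ltrBlDr ltrDl weight_gt0.
have missL t : miss L t <= c.
  have [k kL kn] := HL t.
  have Ln : near_integer d (walk t (nseq L i)).
    apply: (walk_nseq_near kL).
    by have [//|->] := walk_nseq t k.
  rewrite /miss /c lerBrDr -[leRHS](level_sum_cst hp L 1) /level_sum.
  rewrite (bigD1 [tuple of nseq L i])//= Ln mulr0 add0r.
  rewrite [leRHS](bigD1 [tuple of nseq L i])//= mulr1 [leRHS]addrC lerD2r.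
  apply: ler_sum => v _; rewrite mulr1 ler_piMr//; first by rewrite ltW// weight_gt0.
  by case: near_integer.
have c0 : 0 <= c by apply: le_trans (missL 0); exact: miss_ge0.
have missrL r t : miss (r * L) t <= c ^+ r.
  elim: r t => [|r IH] t.
    rewrite expr0 -[leRHS](level_sum_cst hp (0 * L) 1); apply: le_level_sum => // v _.
    by case: near_integer.
  rewrite mulSn exprS; apply: (le_trans (missD_le _ _ missL)).
  by rewrite ler_wpM2l.
have [r hr] : exists r, c ^+ r <= e.
  have : (c ^+ r @[r --> \oo] --> (0:R)).
    by apply: cvg_expr; rewrite ger0_norm.
  move/cvgrPdist_le => /(_ e e0)[r _ /(_ r (leqnn _))] /=.
  by rewrite sub0r normrN ger0_norm ?exprn_ge0// => H; exists r.
exists (r * L)%N => k t /subnKC <-.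
(* The [k - r * L] surplus steps are made first; the bound on the last [r * L] steps holds wherever
   they start. *)
rewrite missD -[leRHS](level_sum_cst hp (k - r * L) e); apply: le_level_sum => // v _.
exact: le_trans (missrL _ _) hr.
Qed.

End coupling.

(** * The skew product *)

Section circle_rotation.
Context {R : realType}.
Implicit Types (t s : R) (u v : circle R).

Definition rotation t u : circle R := circle_frac (circle_val u + t).

Lemma circle_val_itv u : 0 <= circle_val u < 1.
Proof. exact: svalP u. Qed.

Lemma floor_circle_val u : Num.floor (circle_val u) = 0.
Proof. by apply/eqP; rewrite floor_eq add0r; exact: circle_val_itv. Qed.

Lemma circle_valK u : circle_frac (circle_val u) = u.
Proof. by apply: circle_val_inj; rewrite /= floor_circle_val subr0. Qed.

Lemma circle_fracD t (k : int) : circle_frac (t + k%:~R) = circle_frac t.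
Proof.
apply: circle_val_inj => /=; rewrite floorDrz ?intr_int// intrKfloor intrD; ring.
Qed.

Lemma circle_frac_valD t s :
  circle_frac (circle_val (circle_frac t) + s) = circle_frac (t + s).
Proof.
by rewrite [circle_val _]/= -addrA (addrC _ s) addrA -mulrNz circle_fracD.
Qed.

Lemma rotationD t s u : rotation t (rotation s u) = rotation (s + t) u.
Proof. by rewrite /rotation circle_frac_valD addrA. Qed.

Lemma rotation_int (k : int) u : rotation k%:~R u = u.
Proof. by rewrite /rotation circle_fracD circle_valK. Qed.

Lemma rotationK t u : rotation (- t) (rotation t u) = u.
Proof. by rewrite rotationD subrr (rotation_int 0). Qed.

Lemma rotationNK t u : rotation t (rotation (- t) u) = u.
Proof. by rewrite rotationD addNr (rotation_int 0). Qed.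

Lemma rotationDz t (k : int) u : rotation (t + k%:~R) u = rotation t u.
Proof. by rewrite -rotationD rotation_int. Qed.

Lemma circle_addE u v : circle_add u v = rotation (circle_val v) u.
Proof. by []. Qed.

Lemma rotation_val t u :
  exists k : int, circle_val (rotation t u) = circle_val u + t + k%:~R.
Proof. by exists (- Num.floor (circle_val u + t)); rewrite mulrNz. Qed.

(** Rotation by [t] in [[0, 1)], read on the line as a translation on each of two intervals. *)
Let unwrap t (x : measurableTypeR R) : measurableTypeR R :=
  if x + t < 1 then x + t else x + (t - 1).

Let rotation_unwrap t u : 0 <= t < 1 ->
  circle_val (rotation t u) = unwrap t (circle_val u).
Proof.
move=> /andP[t0 t1]; have /andP[u0 u1] := circle_val_itv u.
rewrite /rotation /unwrap [LHS]/=; case: ifPn => [ut|].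
  rewrite (_ : Num.floor _ = 0) ?subr0//; apply/eqP.
  by rewrite floor_eq add0r ut addr_ge0.
rewrite -leNgt => ut; rewrite (_ : Num.floor _ = 1) ?addrA//; apply/eqP.
by rewrite floor_eq ut/=; lra.
Qed.

Let rotation01 t : exists s, 0 <= s < 1 /\ rotation t = rotation s.
Proof.
exists (t - (Num.floor t)%:~R); split; first exact: frac_itv.
by apply/funext => u; rewrite -mulrNz rotationDz.
Qed.

Let measurable_translation t :
  measurable_fun setT (fun x : measurableTypeR R => x + t : measurableTypeR R).
Proof. exact: measurable_funD. Qed.

(** The translated measure gives half-open intervals their length, which characterises Lebesgue
    measure. *)
Lemma lebesgue_measure_translation t (A : set (measurableTypeR R)) :
  measurable A -> lebesgue_measure ((fun x => x + t) @^-1` A) = lebesgue_measure A.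
Proof.
move=> mA; apply/esym.
pose m := pushforward (@lebesgue_measure R)
  (fun x : measurableTypeR R => x + t : measurableTypeR R).
apply: (@lebesgue_measure_unique R m) => // _ [[a b]] _ <-.
have E : (fun x => x + t) @^-1` `]a, b] = [set` `]a - t, b - t]].
  by apply/seteqP; split=> x /=; rewrite !in_itv/= ltrBlDr lerBrDr.
rewrite /m /pushforward [X in _ = lebesgue_measure X]E.
rewrite !lebesgue_measure_itv/= !lte_fin ltrD2r.
by case: ifP => // _; rewrite -!EFinD; congr EFin; ring.
Qed.

Lemma measurable_rotation t : measurable_fun setT (rotation t).
Proof.
have [s [s01 ->]] := rotation01 t.
have mu : measurable_fun setT (unwrap s).
  apply: measurable_fun_ifT; [|exact: measurable_translation..].
  by apply: measurable_fun_ltr => //; exact: measurable_translation.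
move=> _ _ [B mB <-]; rewrite !setTI.
exists (unwrap s @^-1` B); first by rewrite -[X in measurable X]setTI; exact: mu.
by rewrite setTI; apply/seteqP; split=> u /=; rewrite -rotation_unwrap.
Qed.

(** The circle is cut at the point that the rotation sends to 0. On the two pieces the preimage of
    [B] is a translate of [B] cut to [[s, 1)] and of [B] cut to [[0, s)]. *)
Lemma circle_lebesgue_rotation t (A : set (circle R)) : measurable A ->
  circle_lebesgue R (rotation t @^-1` A) = circle_lebesgue R A.
Proof.
have [s [s01 ->]] := rotation01 t; have /andP[s0 s1] := s01.
move=> [B mB <-]; rewrite setTI /circle_lebesgue.
pose P1 : set (measurableTypeR R) := B `&` `[s, 1[.
pose P2 : set (measurableTypeR R) := B `&` `[0, s[.
have mP1 : measurable P1 by apply: measurableI => //; exact: measurable_itv.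
have mP2 : measurable P2 by apply: measurableI => //; exact: measurable_itv.
have -> : circle_val @` (rotation s @^-1` (unit_arc_val @^-1` B)) =
    ((fun x => x + s) @^-1` P1) `|` ((fun x => x + (s - 1)) @^-1` P2).
  apply/seteqP; split=> [_ [u Bu <-]|x].
    have /andP[u0 u1] := circle_val_itv u.
    have {Bu} : B (unwrap s (circle_val u)) by rewrite -rotation_unwrap.
    rewrite /unwrap.
    case: ifPn => [us Bu|]; [left|rewrite -leNgt => us Bu; right];
      by split => //=; rewrite in_itv/=; apply/andP; split; lra.
  have H : 0 <= x < 1 -> B (unwrap s x) ->
      [set circle_val x | x in rotation s @^-1` (unit_arc_val @^-1` B)] x.
    move=> x01 Bx; exists (exist _ x x01) => //=.
    by move: Bx; rewrite -(rotation_unwrap (exist _ x x01)).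
  case=> -[]/= Bx; rewrite in_itv/= => /andP[x0 x1]; apply: H.
  - by apply/andP; split; lra.
  - by rewrite /unwrap x1.
  - by apply/andP; split; lra.
  - by rewrite /unwrap ifF//; apply/negbTE; rewrite -leNgt; lra.
have mt (r : R) (P : set (measurableTypeR R)) : measurable P ->
    measurable ((fun x => x + r) @^-1` P : set (measurableTypeR R)).
  by move=> mP; rewrite -[X in measurable X]setTI; exact: measurable_translation.
rewrite measureU; [|exact: mt|exact: mt|]; last first.
  rewrite -subset0 => x [] [/= _]; rewrite in_itv/= => /andP[x0 x1] [_].
  by rewrite /= in_itv/= => /andP[x2 x3]; lra.
rewrite [X in (X + _)%E](lebesgue_measure_translation s mP1).
rewrite [X in (_ + X)%E](lebesgue_measure_translation (s - 1) mP2).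
rewrite -measureU//; last first.
  rewrite -subset0 => x [] [/= _]; rewrite in_itv/= => /andP[x0 x1] [_].
  by rewrite /= in_itv/= => /andP[x2 x3]; lra.
rewrite -[X in _ = lebesgue_measure (_ @` X)]/(circle_val @^-1` B) image_circle_val.
congr (lebesgue_measure _); apply/seteqP; split=> x.
  by case=> -[Bx]; rewrite /= in_itv/= => /andP[x0 x1];
    split => //; rewrite in_itv/=; apply/andP; split; lra.
case=> Bx; rewrite /= in_itv/= => /andP[x0 x1].
have [xs|xs] := leP s x; [left|right]; split => //=;
  by rewrite in_itv/=; apply/andP; split; lra.
Qed.

End circle_rotation.

(** * The skew shift and its random backward orbits *)

Section skew_product.
Context {R : realType} {n : nat} (p : 'I_n.+1 -> R) (hp : positive_prob_vector p).
Variables (g : 'I_n.+1 -> circle R) (mu : probability (seqspace n) R).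
Hypothesis hmu : is_product_measure p mu.

Local Notation X := (seqspace n * circle R)%type.
Local Notation S := (skew_shift g).
Definition skew_measure : probability X R := (mu \x circle_lebesgue R)%E.
Local Notation lam := skew_measure.

Definition scons (j : 'I_n.+1) (x : seqspace n) : seqspace n :=
  fun k => if k is k'.+1 then x k' else j.

Definition sshift (x : seqspace n) : seqspace n := fun k => x k.+1.

Definition first_symbol (z : X) : 'I_n.+1 := z.1 0%N.

Definition branch j (z : X) : X := (scons j z.1, rotation (- circle_val (g j)) z.2).

Lemma scons_sshift x : scons (x 0%N) (sshift x) = x.
Proof. by apply/funext; case. Qed.

Lemma skew_shiftE z :
  S z = (sshift z.1, rotation (circle_val (g (first_symbol z))) z.2).
Proof. by []. Qed.

Lemma branchK j : cancel (branch j) S.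
Proof. by case=> x u; rewrite skew_shiftE /= rotationNK. Qed.

Lemma branch_skew_shift z : branch (first_symbol z) (S z) = z.
Proof. by case: z => x u; rewrite skew_shiftE /branch /= rotationK scons_sshift. Qed.

Lemma measurable_coordinate k j : measurable [set x : seqspace n | x k = j].
Proof. by apply: sub_sigma_algebra; exists k, j. Qed.

Lemma measurable_sshift : measurable_fun setT sshift.
Proof.
apply: (@measurability _ _ (seqspace n) (seqspace n) setT sshift
  (@coordinate_sets n)) => //.
by move=> _ [_ [k [j ->]] <-]; rewrite setTI; exact: (measurable_coordinate k.+1).
Qed.

Lemma measurable_scons j : measurable_fun setT (scons j).
Proof.
apply: (@measurability _ _ (seqspace n) (seqspace n) setT (scons j)
  (@coordinate_sets n)) => //.
move=> _ [_ [k [i ->]] <-]; rewrite setTI.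
case: k => [|k]; last exact: (measurable_coordinate k).
have [->|ji] := eqVneq j i.
  by rewrite (_ : _ @^-1` _ = setT)//; apply/seteqP; split.
by rewrite (_ : _ @^-1` _ = set0)//; apply/seteqP; split => // x /= /eqP;
  rewrite (negbTE ji).
Qed.

Lemma measurable_branch j : measurable_fun setT (branch j).
Proof.
apply: measurable_fun_pair.
  exact: measurableT_comp (measurable_scons j) measurable_fst.
exact: measurableT_comp (measurable_rotation _) measurable_snd.
Qed.

Lemma measurable_first_symbol j : measurable [set z : X | first_symbol z = j].
Proof.
rewrite -[X in measurable X]setTI.
exact: (@measurable_fst _ _ _ _ measurableT _ (measurable_coordinate 0 j)).
Qed.

(** Once the first symbol is fixed, the skew shift is a product of the shift and one rotation, which
    gives measurability piece by piece. *)
Lemma skew_shift_preimage (B : set X) :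
  S @^-1` B = \bigcup_j ([set z | first_symbol z = j] `&`
    (fun z : X => (sshift z.1, rotation (circle_val (g j)) z.2)) @^-1` B).
Proof.
apply/seteqP; split=> [z Bz|z [j _ [<-]]//].
by exists (first_symbol z).
Qed.

Lemma measurable_skew_shift : measurable_fun setT S.
Proof.
move=> _ B mB; rewrite setTI skew_shift_preimage.
apply: fin_bigcup_measurable => [|j _]; first exact: finite_finset.
apply: measurableI; first exact: measurable_first_symbol.
rewrite -[X in measurable X]setTI.
have mf : measurable_fun setT (fun z : X =>
    (sshift z.1, rotation (circle_val (g j)) z.2)).
  apply: measurable_fun_pair.
    exact: measurableT_comp measurable_sshift measurable_fst.
  exact: measurableT_comp (measurable_rotation _) measurable_snd.
exact: mf.
Qed.

Lemma measurable_preimageT (d d' : measure_display) (T : measurableType d)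
  (T' : measurableType d') (f : T -> T') (B : set T') :
  measurable_fun setT f -> measurable B -> measurable (f @^-1` B).
Proof. by move=> mf mB; rewrite -[X in measurable X]setTI; exact: mf. Qed.

Let cylinder m (a : nat -> 'I_n.+1) : set (seqspace n) :=
  [set x | forall k, (k < m)%N -> x k = a k].

(** The empty set is included because two cylinders may be disjoint, and a pi-system is wanted. *)
Let cylinders : set (set (seqspace n)) :=
  [set C | C = set0 \/ exists m a, C = cylinder m a].

Let measurable_cylinder m a : measurable (cylinder m a).
Proof.
rewrite (_ : cylinder m a = \bigcap_(k in `I_m) [set x | x k = a k])//.
by apply: fin_bigcap_measurable => // k _; exact: measurable_coordinate.
Qed.

Let cylindersI : setI_closed cylinders.
Proof.
move=> A B [->|[m [a ->]]]; first by left; rewrite set0I.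
case=> [->|[l [b ->]]]; first by left; rewrite setI0.
wlog ml : m l a b / (m <= l)%N.
  move=> W; case: (leqP m l) => [/W|/ltnW/W]; first exact.
  by rewrite setIC; exact.
have [E|E] := pselect (exists2 k, (k < m)%N & a k <> b k).
  have [k km akbk] := E; left; rewrite -subset0 => x [/= xa xb].
  by apply: akbk; rewrite -(xa k km) -(xb k (leq_trans km ml)).
right; exists l, b; apply/seteqP; split=> [x []//|x xb]; split=> //= k km.
rewrite xb ?(leq_trans km ml)//; apply: contrapT => ba; apply: E.
by exists k => // /esym.
Qed.

(** A condition on coordinate [k] alone is the finite union, over the words of length [k] that may
    precede it, of cylinders of length [k.+1]. *)
Let coordinate_cylinders : @coordinate_sets n `<=` <<s cylinders >>.
Proof.
move=> _ [k [j ->]].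
pose a (w : k.-tuple 'I_n.+1) l := nth ord0 (rcons w j) l.
rewrite (_ : [set x | x k = j] = \bigcup_w cylinder k.+1 (a w)).
  apply: (@fin_bigcup_measurable _ (g_sigma_algebraType cylinders)).
    exact: finite_finset.
  by move=> w _; apply: sub_sigma_algebra; right; exists k.+1, (a w).
apply/seteqP; split=> [x /= xj|x [w _ /= /(_ k (leqnn _))]]; last first.
  by rewrite /a nth_rcons size_tuple ltnn eqxx.
exists [tuple x (val l) | l < k] => // l; rewrite /a nth_rcons size_tuple ltnS.
rewrite leq_eqVlt => /orP[/eqP->|lk]; first by rewrite ltnn eqxx.
by rewrite lk -[l]/(val (Ordinal lk)) nth_mktuple.
Qed.

Let eq_on_cylinders (m1 m2 : {measure set (seqspace n) -> \bar R}) :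
  (m1 setT < +oo)%E -> (forall m a, m1 (cylinder m a) = m2 (cylinder m a)) ->
  forall B, measurable B -> m1 B = m2 B.
Proof.
move=> m1oo m12 B mB.
have cylT : cylinder 0 (fun=> ord0) = setT by apply/seteqP; split.
apply: (g_sigma_algebra_measure_unique cylinders _ (fun=> cylinder 0 (fun=> ord0))).
- move=> _ [->|[m [a ->]]]; [exact: measurable0|exact: measurable_cylinder].
- by move=> _; right; exists 0%N, (fun=> ord0).
- by rewrite bigcup_const// ; exists 0%N.
- exact: cylindersI.
- by move=> _ [->|[m [a ->]]]; rewrite ?measure0.
- by move=> _; rewrite cylT.
- apply: (smallest_sub _ _ mB); first exact: smallest_sigma_algebra.
  exact: coordinate_cylinders.
Qed.

(** Both sides are finite measures in [B]. They agree on cylinders, since putting [j] in front of a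
    cylinder multiplies its measure by [p j]. *)
Let prob_first_coordinate_shift j (B : set (seqspace n)) : measurable B ->
  mu ([set x | x 0%N = j] `&` sshift @^-1` B) = ((p j)%:E * mu B)%E.
Proof.
move=> mB; have pj : 0 <= p j by exact/ltW/hp.1.
pose m2 := mscale (NngNum pj) mu.
pose m1 := pushforward (mrestr mu (measurable_coordinate 0 j)) sshift.
transitivity (m1 B); first by rewrite /m1 /pushforward /mrestr setIC.
apply: (@eq_on_cylinders m1 m2) => //; first exact: measurable_sshift.
  have : (mu ([set: seqspace n] `&` [set x | x 0%N = j]) <= 1)%E.
    by apply: probability_le1; rewrite setTI; exact: measurable_coordinate.
  by move/le_lt_trans => H ms; apply: H; rewrite ltry.
move=> ms m a.
have cylE k b : mu (cylinder k b) = (\prod_(l < k) p (b l))%:E := hmu k b.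
transitivity (mu (cylinder m.+1 (scons j a))); last first.
  transitivity ((p j)%:E * mu (cylinder m a))%E; last by [].
  by rewrite !cylE big_ord_recl EFinM.
transitivity (mu (sshift @^-1` cylinder m a `&` [set x | x 0%N = j])) => //.
congr (mu _).
apply/seteqP; split=> [x [/= xa xj] [|k]//= km|x xa]; first exact: xa.
split=> [k km|]; first exact: (xa k.+1).
exact: (xa 0%N).
Qed.

(** Divided by [p j], the left side is a measure in [B] that has the product value on rectangles, by
    the shift formula and the rotation invariance; uniqueness of the product measure concludes. *)
Lemma fiber_prob j (B : set X) : measurable B ->
  lam ([set z | first_symbol z = j] `&` S @^-1` B) = ((p j)%:E * lam B)%E.
Proof.
move=> mB; have pj := hp.1 j; have pj' : 0 <= (p j)^-1 by rewrite invr_ge0 ltW.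
pose m0 := pushforward (mrestr lam (measurable_first_symbol j)) S.
pose m := mscale (NngNum pj') m0.
have -> : lam B = m measurable_skew_shift B.
  apply: (@product_measure_unique _ _ _ _ _ mu (circle_lebesgue R)) => //.
  move=> C D mC mD.
  have E : S @^-1` (C `*` D) `&` [set z | first_symbol z = j] =
      ([set x | x 0%N = j] `&` sshift @^-1` C) `*`
      (rotation (circle_val (g j)) @^-1` D).
    apply/seteqP; split=> [[x u] [[/= Cx Du] xj]|[x u] [[/= xj Cx] Du]].
      by split => //=; rewrite -xj.
    by split => //; split => //=; rewrite circle_addE xj.
  transitivity (((p j)^-1)%:E *
      lam (S @^-1` (C `*` D) `&` [set z | first_symbol z = j]))%E => //.
  rewrite E.
  rewrite [X in (_ * X)%E](@product_measure1E _ _ _ _ _ mu)//; first last.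
  - exact: measurable_preimageT (measurable_rotation _) mD.
  - apply: measurableI; first exact: measurable_coordinate.
    exact: measurable_preimageT measurable_sshift mC.
  rewrite [X in (_ * (X * _))%E](prob_first_coordinate_shift j mC).
  rewrite [X in (_ * (_ * X))%E](circle_lebesgue_rotation _ mD) !muleA -EFinM.
  by rewrite mulVf ?mul1e// gt_eqF.
transitivity ((p j)%:E * (((p j)^-1)%:E *
    lam (S @^-1` B `&` [set z | first_symbol z = j])))%E => //.
by rewrite muleA -EFinM mulfV ?gt_eqF// mul1e setIC.
Qed.

(** The branch [j] carries [lam] to [lam] conditioned on the first symbol [j]. *)
Lemma branch_prob j (B : set X) : measurable B ->
  ((p j)%:E * lam (branch j @^-1` B) = lam ([set z | first_symbol z = j] `&` B))%E.
Proof.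
move=> mB; rewrite -fiber_prob; last first.
  exact: measurable_preimageT (measurable_branch j) mB.
congr (lam _); apply/seteqP; split=> z [/= <-]; rewrite branch_skew_shift//.
Qed.

Lemma lam_symbol_sum (B : set X) : measurable B ->
  lam B = (\sum_(j < n.+1) lam ([set z | first_symbol z = j] `&` B))%E.
Proof.
move=> mB; rewrite -measure_bigsetU_ord /=; first last.
- apply/trivIsetP => i j _ _ /eqP ij; rewrite -subset0 => z [[/= zi _] [zj _]].
  by apply: ij; rewrite -zi.
- by move=> j; apply: measurableI => //; exact: measurable_first_symbol.
congr (lam _); rewrite -bigcup_seq; apply/seteqP; split=> [z Bz|z [j _ []]//].
by exists (first_symbol z); rewrite //= mem_index_enum.
Qed.

Lemma skew_shift_preserving : measure_preserving lam S.
Proof.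
split; first exact: measurable_skew_shift.
move=> B mB.
rewrite [LHS](lam_symbol_sum (measurable_preimageT measurable_skew_shift mB)).
under eq_bigr => j _ do rewrite fiber_prob//.
rewrite -ge0_sume_distrl; last by move=> j _; rewrite lee_fin ltW// hp.1.
by rewrite sumEFin hp.2 mul1e.
Qed.

Lemma first_symbol_tree_partition : tree_partition p lam S first_symbol.
Proof.
split; first exact: measurable_first_symbol.
- apply/aeW => z j; exists (branch j z); split; first by rewrite branchK.
  by move=> y [<- <-]; rewrite branch_skew_shift.
- move=> j; split; first exact: measurable_cst.
  move=> B mB; apply: etrans (fiber_prob j mB) _; apply/esym.
  exact: (@integral_cst _ _ _ lam _ mB (p j)%:E).
Qed.

Lemma preimage_branchE j z : preimage_branch S first_symbol j z = branch j z.
Proof.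
rewrite /preimage_branch; case: xgetP => [y _ [<- <-]|/(_ (branch j z))[]].
  by rewrite branch_skew_shift.
by split; first exact: branchK.
Qed.

Definition node v (z : X) : X := foldr branch z v.

Lemma node_branchE v z : node_branch S first_symbol v z = node v z.
Proof. by elim: v => //= j v; rewrite preimage_branchE => <-. Qed.

Lemma measurable_node v : measurable_fun setT (node v).
Proof.
elim: v => [|j v IH]; first exact: measurable_id.
exact: measurableT_comp (measurable_branch j) IH.
Qed.

Let mass (B : set X) : R := fine (lam B).

Let massE (B : set X) : measurable B -> lam B = (mass B)%:E.
Proof. by move=> mB; rewrite fineK// fin_num_measure. Qed.

Let branch_mass (B : set X) : measurable B ->
  \sum_j p j * mass (branch j @^-1` B) = mass B.
Proof.
move=> mB; apply: EFin_inj; rewrite -massE// lam_symbol_sum// -sumEFin.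
apply: eq_bigr => j _; rewrite -branch_prob// EFinM massE//.
exact: measurable_preimageT (measurable_branch j) mB.
Qed.

(** Stationarity: [lam] is invariant under the Markov chain that moves from a point to a random
    preimage. *)
Let node_mass k (B : set X) : measurable B ->
  level_sum p k (fun v => mass (node v @^-1` B)) = mass B.
Proof.
elim: k B => [|k IH] B mB; first by rewrite level_sum0.
have mb j : measurable (branch j @^-1` B).
  exact: measurable_preimageT (measurable_branch j) mB.
rewrite level_sumS -[RHS]branch_mass// /level_sum.
under [RHS]eq_bigr => j _ do rewrite -IH// mulr_sumr.
rewrite exchange_big /=; apply: eq_bigr => v _; rewrite mulr_sumr.
by apply: eq_bigr => j _; rewrite mulrCA.
Qed.

(** The expected number of visits to [B] in the first [m] steps of a random backward orbit of
    [z]. *)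
Definition visits m (B : set X) (z : X) : R :=
  \sum_(1 <= k < m.+1) level_sum p k (fun v => \1_B (node v z)).

Lemma measurable_visits m (B : set X) : measurable B ->
  measurable_fun setT (visits m B).
Proof.
move=> mB; apply: measurable_sum => k; apply: measurable_sum => v.
apply: measurable_funM => //.
exact: measurableT_comp (measurable_indic mB) (measurable_node v).
Qed.

Lemma visits_ge0 m (B : set X) z : 0 <= visits m B z.
Proof.
apply: sumr_ge0 => k _; rewrite -(level_sum_cst hp k 0).
by apply: le_level_sum.
Qed.

Lemma integral_visits m (B : set X) : measurable B ->
  (\int[lam]_z (visits m B z)%:E = m%:R%:E * lam B)%E.
Proof.
move=> mB; under eq_integral do rewrite -sumEFin.
have mi (v : seq 'I_n.+1) : measurable_fun setT (fun z => (\1_B (node v z) : R)).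
  exact: measurableT_comp (measurable_indic mB) (measurable_node v).
have ml k : measurable_fun setT (fun z => level_sum p k (fun v => \1_B (node v z))).
  by apply: measurable_sum => v; apply: measurable_funM.
rewrite ge0_integral_sum//; first last.
- move=> k z _; rewrite lee_fin -(level_sum_cst hp k 0); exact: le_level_sum.
- by move=> k; exact/measurable_EFinP.
rewrite (eq_bigr (fun=> lam B)) => [|k _].
  by rewrite massE// sumEFin sumr_const_nat subSS subn0 -EFinM mulr_natl.
under eq_integral do rewrite /level_sum -sumEFin.
rewrite ge0_integral_sum//; first last.
- by move=> v z _; rewrite lee_fin mulr_ge0// ltW// weight_gt0.
- by move=> v; apply/measurable_EFinP; apply: measurable_funM.
rewrite massE// -(node_mass k mB) /level_sum -sumEFin; apply: eq_bigr => v _.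
under eq_integral do rewrite EFinM.
rewrite ge0_integralZl_EFin//; first last.
- by rewrite ltW// weight_gt0.
- exact/measurable_EFinP.
rewrite EFinM; congr (_ * _)%E.
have mvB := measurable_preimageT (measurable_node v) mB.
by rewrite -massE// -[in RHS](setIT (node v @^-1` B)) -integral_indic.
Qed.

(** Markov's inequality: the integral of [visits m B] is at most [m * c * e], so its value is
    [m * c] or more on a set of measure at most [e]. *)
Lemma visits_markov m (B : set X) c e : measurable B -> 0 < c -> (0 < m)%N ->
  (lam B <= (c * e)%:E)%E ->
  exists H, [/\ measurable H, ((1 - e)%:E <= lam H)%E &
    forall z, H z -> visits m B z <= m%:R * c].
Proof.
move=> mB c0 m0 Bce; set f := visits m B.
have mf : measurable_fun setT f by exact: measurable_visits.
have m0' : 0 < m%:R :> R by rewrite ltr0n.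
pose E := [set z | m%:R * c <= f z].
have mE : measurable E.
  rewrite (_ : E = f @^-1` `[m%:R * c, +oo[).
    exact: measurable_preimageT mf (measurable_itv _).
  by apply/seteqP; split=> z; rewrite /E /= in_itv/= andbT.
have mc0 : 0 < m%:R * c by rewrite mulr_gt0.
have : ((m%:R * c)%:E * lam E <= m%:R%:E * lam B)%E.
  rewrite -integral_visits//.
  have -> : E = setT `&` [set z | ((m%:R * c)%:E <= `|(f z)%:E|)%E].
    rewrite setTI; apply/seteqP.
    by split=> z; rewrite /E /= lee_fin ger0_norm ?visits_ge0.
  under eq_integral => z _ do
    rewrite -(gee0_abs (x := (f z)%:E)) ?lee_fin ?visits_ge0//.
  apply: (@le_integral_comp_abse _ _ _ _ _ _ _ _ idfun) => //.
  exact: measurable_id.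
  exact/measurable_EFinP.
rewrite (massE mE) (massE mB) -!EFinM lee_fin -mulrA ler_pM2l// => H1.
have H2 : mass E <= e.
  rewrite -(ler_pM2l c0); apply: (le_trans H1).
  by rewrite -lee_fin -massE.
exists (~` E); split; first exact: measurableC.
- by rewrite probability_setC// (massE mE) -EFinB lee_fin lerB.
- by move=> z /negP; rewrite -ltNge => /ltW.
Qed.

End skew_product.

(** * Approximation by uniformly continuous functions *)

Section lusin.
Context {R : realType} {n : nat} (mu : probability (seqspace n) R).

Local Notation X := (seqspace n * circle R)%type.
Local Notation lam := (@skew_measure R n mu).

(** A basic entourage of the product of the sequence space and the circle; the angles are compared
    modulo 1. *)
Definition nearby L d (z z' : X) : Prop :=
  (forall k, (k < L)%N -> z.1 k = z'.1 k) /\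
  near_integer d (circle_val z'.2 - circle_val z.2).

Lemma nearby_le L L' d d' z z' : (L' <= L)%N -> d <= d' ->
  nearby L d z z' -> nearby L' d' z z'.
Proof.
move=> LL dd [zk /asboolP[k kd]]; split.
  by move=> l lL; apply: zk; exact: leq_trans LL.
by apply/asboolP; exists k; exact: lt_le_trans dd.
Qed.

(* The indicator of B is uniformly continuous outside sets of small measure. *)
Definition lusin (B : set X) : Prop := forall e, 0 < e ->
  exists L d Z, [/\ 0 < d, measurable Z, (lam Z <= e%:E)%E &
    forall z z', ~ Z z -> ~ Z z' -> nearby L d z z' -> (B z <-> B z')].

Lemma measureU_le (A B : set X) a b : measurable A -> measurable B ->
  (lam A <= a%:E)%E -> (lam B <= b%:E)%E -> (lam (A `|` B) <= (a + b)%:E)%E.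
Proof.
move=> mA mB Aa Bb; apply: (le_trans (measureU2 _ mA mB)).
by rewrite EFinD leeD.
Qed.

Lemma lusinC B : lusin B -> lusin (~` B).
Proof.
move=> HB e /HB[L [d [Z [d0 mZ Ze H]]]]; exists L, d, Z; split => // z z' zZ zZ' c.
by split; apply: contra_not => /(H _ _ zZ zZ' c).
Qed.

Lemma lusin_seq (I : eqType) (s : seq I) (F : I -> set X) :
  (forall i, i \in s -> lusin (F i)) -> forall e, 0 < e ->
  exists L d Z, [/\ 0 < d, measurable Z, (lam Z <= e%:E)%E &
    forall z z', ~ Z z -> ~ Z z' -> nearby L d z z' ->
    forall i, i \in s -> (F i z <-> F i z')].
Proof.
elim: s => [_ e e0|i s IH HF e e0].
  by exists 0%N, 1, set0; split => //; rewrite measure0 lee_fin ltW.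
have e2 : 0 < e / 2 by rewrite divr_gt0.
have [|L [d [Z [d0 mZ Ze H]]]] := HF i _ _ e2; first by rewrite mem_head.
have [|L' [d' [Z' [d0' mZ' Ze' H']]]] := IH _ _ e2.
  by move=> j js; apply: HF; rewrite inE js orbT.
exists (maxn L L'), (Num.min d d'), (Z `|` Z'); split.
- by rewrite lt_min d0.
- exact: measurableU.
- by rewrite (splitr e); exact: measureU_le.
- move=> z z' /not_orP[zZ zZ'] /not_orP[z'Z z'Z'] c j.
  rewrite inE => /orP[/eqP->|js].
    by apply: H => //; apply: nearby_le c; rewrite ?leq_maxl ?ge_min ?lexx.
  by apply: H' => //; apply: nearby_le c; rewrite ?leq_maxr ?ge_min ?lexx ?orbT.
Qed.

(** By continuity of the measure a finite subunion fills the union up to measure [e / 2]. That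
    remainder joins the exceptional set of the finite family. *)
Lemma lusin_bigcup (F : nat -> set X) :
  (forall i, measurable (F i)) -> (forall i, lusin (F i)) ->
  lusin (\bigcup_i F i).
Proof.
move=> mF lF e e0.
have e2 : 0 < e / 2 by rewrite divr_gt0.
pose G N := \bigcup_(i < N) F i.
have mG N : measurable (G N) by apply: bigcup_measurable => k _; exact: mF.
have mU : measurable (\bigcup_i F i) by exact: bigcupT_measurable.
have [N HN] : exists N, (lam ((\bigcup_i F i) `\` G N) <= (e / 2)%:E)%E.
  have : lam \o (fun N => (\bigcup_i F i) `\` G N) @ \oo -->
      lam (\bigcap_N ((\bigcup_i F i) `\` G N)).
    apply: nonincreasing_cvg_mu.
    - apply: (le_lt_trans (probability_le1 _ _)); rewrite ?ltry//.
      exact: measurableD.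
    - by move=> N; exact: measurableD.
    - by apply: bigcapT_measurable => N; exact: measurableD.
    - move=> N N' NN'; apply/subsetPset => z [Uz GN']; split=> //.
      by apply: contra_not GN' => -[i /= iN Fi]; exists i => //=; exact: leq_trans NN'.
  have -> : \bigcap_N ((\bigcup_i F i) `\` G N) = set0.
    rewrite -subset0 => z H; have [[i _ Fi] _] := H 0%N Logic.I.
    by have [_] := H i.+1 Logic.I; apply; exists i => /=.
  rewrite measure0 => /fine_cvgP[] [N0 _ H0] /cvgrPdist_le /(_ _ e2) [N1 _ H1].
  exists (maxn N0 N1).
  have := H1 (maxn N0 N1) (leq_maxr _ _); rewrite sub0r normrN => /ler_normlW.
  rewrite -lee_fin /= fineK//.
  by have := H0 (maxn N0 N1) (leq_maxl _ _).
have [L [d [Z [d0 mZ Ze H]]]] := @lusin_seq _ (iota 0 N) F (fun i _ => lF i) _ e2.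
exists L, d, (Z `|` ((\bigcup_i F i) `\` G N)); split=> //.
- by apply: measurableU => //; exact: measurableD.
- by rewrite (splitr e); apply: measureU_le => //; exact: measurableD.
have G_iff z : ~ ((\bigcup_i F i) `\` G N) z -> (\bigcup_i F i) z ->
    exists2 i, i \in iota 0 N & F i z.
  move=> nz Uz; have : G N z by apply: contrapT => Gz; apply: nz.
  by move=> [i /= iN Fi]; exists i => //; rewrite mem_iota.
move=> z z' /not_orP[zZ zG] /not_orP[zZ' zG'] c; split.
- by move=> /(G_iff _ zG)[i iN /(H _ _ zZ zZ' c i iN)]; exists i.
- by move=> /(G_iff _ zG')[i iN /(H _ _ zZ zZ' c i iN)]; exists i.
Qed.

(** The sets with a good preimage form a sigma-algebra. Measurability is carried along because
    [lusin_bigcup] requires it. *)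
Lemma lusin_sigma_algebra (T : Type) (f : X -> T) (G : set (set T)) :
  (forall A, G A -> measurable (f @^-1` A) /\ lusin (f @^-1` A)) ->
  forall A, <<s G >> A -> measurable (f @^-1` A) /\ lusin (f @^-1` A).
Proof.
move=> HG; apply: smallest_sub; last exact: HG.
split.
- split; first by rewrite preimage_set0; exact: measurable0.
  move=> e e0; exists 0%N, 1, set0; split=> //.
  by rewrite measure0 lee_fin ltW.
- move=> A [mA lA]; rewrite setTD preimage_setC; split; first exact: measurableC.
  exact: lusinC.
- move=> F HF; rewrite preimage_bigcup; split.
    by apply: bigcupT_measurable => i; have [] := HF i.
  by apply: lusin_bigcup => i; have [] := HF i.
Qed.

Let band (c d : R) : set X := [set z | `|circle_val z.2 - c| < d].

Let measurable_circle_val :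
  measurable_fun setT (@circle_val R : circle R -> measurableTypeR R).
Proof. by move=> _ B mB; exists B. Qed.

Let measurable_val :
  measurable_fun setT (fun z : X => circle_val z.2 : measurableTypeR R).
Proof. exact: measurableT_comp measurable_circle_val measurable_snd. Qed.

Let band_itv c d : band c d =
  setT `*` (@circle_val R @^-1` `]c - d, c + d[).
Proof.
apply/seteqP; split=> z; rewrite /band /= in_itv/= ltr_distl; first by split.
by case.
Qed.

Let measurable_band c d : measurable (band c d).
Proof.
rewrite band_itv; apply: measurableX => //.
exact: measurable_preimageT measurable_circle_val (measurable_itv _).
Qed.

Let lam_band c d : 0 < d -> (lam (band c d) <= (d + d)%:E)%E.
Proof.
move=> d0; rewrite band_itv /skew_measure.
have mI : measurable (@circle_val R @^-1` `]c - d, c + d[).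
  exact: measurable_preimageT measurable_circle_val (measurable_itv _).
rewrite [leLHS](@product_measure1E _ _ _ _ _ mu)//.
rewrite [X in (X * _)%E]probability_setT mul1e /=.
rewrite /circle_lebesgue image_circle_val.
have <- : lebesgue_measure (`]c - d, c + d[%classic : set (measurableTypeR R)) =
    (d + d)%:E.
  rewrite lebesgue_measure_itv/= lte_fin ifT; last lra.
  by rewrite -EFinD; congr EFin; ring.
apply: le_measure; rewrite ?inE.
- by apply: measurableI; exact: measurable_itv.
- exact: measurable_itv.
- exact: subIsetl.
Qed.

Let ray_lusin a : lusin ((fun z : X => circle_val z.2) @^-1` `]a, +oo[).
Proof.
(* Three bands of measure at most [2 * d] are removed: around [a], and around both ends 0 and 1,
   where the coordinate on [[0, 1)] jumps. *)
move=> e e0; pose d := e / 6.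
have d0 : 0 < d by rewrite divr_gt0.
exists 0%N, d, (band a d `|` (band 0 d `|` band 1 d)); split=> //.
- by apply: measurableU => //; exact: measurableU.
- have -> : e = (d + d) + ((d + d) + (d + d)) by rewrite /d; field.
  apply: measureU_le => //; [exact: measurableU|exact: lam_band|].
  by apply: measureU_le => //; exact: lam_band.
move=> [x u] [x' u'] /= /not_orP[ua /not_orP[u0 u1]] /not_orP[ua' /not_orP[u0' u1']].
move=> [_ /asboolP[k /= kd]].
have /andP[v0 v1] := circle_val_itv u; have /andP[v0' v1'] := circle_val_itv u'.
move: ua u0 u1 ua' u0' u1' kd v0 v1 v0' v1'; rewrite /band /= !in_itv/= !andbT.
move: (circle_val u) (circle_val u') => v v'.
move=> /negP va /negP v0 /negP v1 /negP va' /negP v0' /negP v1' kd w0 w1 w0' w1'.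
rewrite -leNgt ger0_norm subr0 // in v0; rewrite -leNgt ger0_norm subr0// in v0'.
have {}v1 : d <= 1 - v by move: v1; rewrite -leNgt distrC ger0_norm// subr_ge0 ltW.
have {}v1' : d <= 1 - v'.
  by move: v1'; rewrite -leNgt distrC ger0_norm// subr_ge0 ltW.
(* Both angles lie in [[d, 1 - d]], so an integer within [d] of their difference is 0: being close
   on the circle means being close on the line. *)
have k0 : k = 0.
  have /andP[k1 k2] : (-1 < k) && (k < 1).
    by rewrite -!(ltr_int R) mulrN1z; move: kd; rewrite ltr_norml; lra.
  by clear - k1 k2; lia.
move: kd va va'; rewrite k0 subr0 -!leNgt ltr_norml => /andP[kd1 kd2].
rewrite !ler_normr => /orP[va|va] /orP[va'|va']; split=> ?; lra.
Qed.

(** The product sigma-algebra is generated by the coordinate sets, which depend on finitely many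
    symbols, and by the rays in the angle, treated in [ray_lusin]. *)
Lemma measurable_lusin (B : set X) : measurable B -> lusin B.
Proof.
have hfst A : measurable A -> measurable (fst @^-1` A : set X) /\ lusin (fst @^-1` A).
  apply: lusin_sigma_algebra => _ [k [j ->]]; split.
    exact: measurable_preimageT measurable_fst (measurable_coordinate k j).
  move=> e e0; exists k.+1, 1, set0; split=> //.
    by rewrite measure0 lee_fin ltW.
  by move=> z z' _ _ [+ _] => /(_ k (leqnn _)) /= ->.
have hval (A : set (measurableTypeR R)) : measurable A ->
    measurable ((fun z : X => circle_val z.2) @^-1` A) /\
    lusin ((fun z : X => circle_val z.2) @^-1` A).
  rewrite RGenOInfty.measurableE; apply: lusin_sigma_algebra => _ [a ->]; split.
    exact: measurable_preimageT measurable_val (measurable_itv _).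
  exact: ray_lusin.
have hsnd A : measurable A -> measurable (snd @^-1` A : set X) /\ lusin (snd @^-1` A).
  by move=> [C mC <-]; rewrite setTI; exact: hval.
move=> mB; suff [] : measurable (id @^-1` B) /\ lusin (id @^-1` B) by [].
move: mB; apply: lusin_sigma_algebra => A [[C mC <-]|[C mC <-]]; rewrite setTI.
  exact: hfst.
exact: hsnd.
Qed.

End lusin.

(** * Sufficiency *)

Section compact_metric.
Context {R : realType} (M : metricType R).
Hypothesis cM : compact [set: M].

Lemma compact_finite_net r : 0 < r ->
  exists s : seq M, forall x, exists2 c, c \in s & (ball c r)° x.
Proof.
move=> r0; have [[x0 _]|M0] := pselect (exists x : M, True); last first.
  by exists [::] => x; exfalso; apply: M0; exists x.
(* compact_cover is stated for pointed spaces only. *)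
pose M' : ptopologicalType :=
  HB.pack (M : Type) (Topological.on M) (isPointed.Build M x0).
have : cover_compact [set: M'] by rewrite -compact_cover.
move=> /(_ M setT (fun c => (ball c r)°)) [].
- by move=> c _; exact: open_interior.
- by move=> x _; exists x => //; exact: nbhsx_ballx.
move=> D _ HD; exists (finmap.enum_fset D) => x.
by have [c cD cx] := HD x Logic.I; exists c.
Qed.

Lemma compact_diameter : exists2 D : R, 0 < D & forall x y : M, mdist x y <= D.
Proof.
have [s Hs] := compact_finite_net ltr01.
(* The sum over the net bounds the distance to each of its centres; the 1 is the radius of the
   balls. *)
pose D x := \sum_(c <- s) mdist x c + 1.
have [[x0 _]|M0] := pselect (exists x : M, True); last first.
  by exists 1 => // x; exfalso; apply: M0; exists x.
have D0 : 0 < D x0 by rewrite ltr_wpDl// sumr_ge0// => c _; exact: mdist_ge0.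
have HD x : mdist x0 x <= D x0.
  have [c cs cx] := Hs x; apply: (le_trans (metric_triangle _ c _)).
  apply: lerD; last first.
    by have /= := interior_subset cx; rewrite ballEmdist => /ltW.
  rewrite (big_rem c)//= lerDl sumr_ge0// => b _; exact: mdist_ge0.
exists (D x0 + D x0); first by rewrite addr_gt0.
move=> x y; apply: (le_trans (metric_triangle _ x0 _)).
by rewrite lerD// metric_sym.
Qed.

End compact_metric.

(** * Matching names by the coupling *)

Section sufficiency.
Context {R : realType} {n : nat} (p : 'I_n.+1 -> R) (hp : positive_prob_vector p).
Variables (g : 'I_n.+1 -> circle R) (mu : probability (seqspace n) R).
Hypothesis hmu : is_product_measure p mu.

Local Notation X := (seqspace n * circle R)%type.
Local Notation S := (skew_shift g).
Local Notation lam := (@skew_measure R n mu).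
Local Notation gam := (fun a => circle_val (g a)).

Lemma node_symbol v z k : (k < size v)%N -> (node g v z).1 k = nth ord0 v k.
Proof. by elim: v k => // a v IH [|k] //=; exact: IH. Qed.

Lemma node_angle v z : exists k : int,
  circle_val (node g v z).2 = circle_val z.2 - \sum_(a <- v) gam a + k%:~R.
Proof.
elim: v => [|a v [k IH]]; first by exists 0; rewrite big_nil subr0 addr0.
have [l lE] := rotation_val (- circle_val (g a)) (node g v z).2.
exists (k + l); rewrite big_cons intrD; apply: (etrans lE).
by rewrite -/(circle_val _) IH; ring.
Qed.

(** If the angles have met by [drop L v], the part nearest the root, the last [L] symbols added are
    common to both nodes. These are the first [L] coordinates of the points reached, and the angle
    difference no longer changes. *)
Lemma close_node_coupling i j d L z z' v : (L <= size v)%N ->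
  let t := circle_val z'.2 - circle_val z.2 in
  near_integer d (walk gam i j d t (drop L v)) ->
  nearby L d (node g v z) (node g (coupling gam i j d t v) z').
Proof.
move=> Lv t td; have vE := cat_take_drop L v.
have cE : coupling gam i j d t v = take L v ++ coupling gam i j d t (drop L v).
  by rewrite -[in LHS]vE coupling_cat_near.
split=> [k kL|].
  rewrite !node_symbol ?size_relabel ?(leq_trans kL)//.
  by rewrite cE nth_cat size_takel// kL nth_take.
have [k kE] := node_angle v z.
have [l lE] := node_angle (coupling gam i j d t v) z'.
have -> : circle_val (node g (coupling gam i j d t v) z').2 -
    circle_val (node g v z).2 = walk gam i j d t v + (l - k)%:~R.
  by rewrite kE lE walkE intrB /t; ring.
by rewrite near_integerD -vE walk_cat walk_near.
Qed.

(** Finitely many balls of radius [r / 2] cover [M]. Their interiors are open, hence have measurable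
    preimages, and outside [Z] nearby points fall in the same ball. *)
Lemma lusin_fun (M : metricType R) (f : X -> M) :
  compact [set: M] -> borel_measurable f -> forall r e, 0 < r -> 0 < e ->
  exists L d Z, [/\ 0 < d, measurable Z, (lam Z <= e%:E)%E &
    forall z z', ~ Z z -> ~ Z z' -> nearby L d z z' -> mdist (f z) (f z') <= r].
Proof.
move=> cM mf r e r0 e0; have r2 : 0 < r / 2 by rewrite divr_gt0.
have [s Hs] := compact_finite_net cM r2.
have lF c : c \in s -> lusin mu (f @^-1` (ball c (r / 2))°).
  by move=> _; apply: measurable_lusin; apply: mf; exact: open_interior.
have [L [d [Z [d0 mZ Ze H]]]] := lusin_seq lF e0.
exists L, d, Z; split=> // z z' zZ zZ' zz'.
have [c cs cz] := Hs (f z).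
have /interior_subset := (H _ _ zZ zZ' zz' c cs).1 cz.
have /= := interior_subset cz; rewrite !ballEmdist /= => cz1 cz2.
apply: (le_trans (metric_triangle _ c _)).
by rewrite metric_sym (splitr r); apply: lerD; exact: ltW.
Qed.

Lemma tbar_le_automorphism (M : metricType R) m (h h' : seq 'I_n.+1 -> M) A :
  tree_automorphism p A ->
  tbar p m h h' <= m%:R^-1 *
    \sum_(1 <= k < m.+1) level_sum p k (fun v => mdist (h v) (h' (A v))).
Proof.
move=> hA; apply: ler_wpM2l; first by rewrite invr_ge0.
apply: ge_inf; last by exists A.
exists 0 => _ [B _ <-]; apply: sumr_ge0 => k _; apply: sumr_ge0 => v _.
by rewrite mulr_ge0 ?mdist_ge0// ltW// weight_gt0.
Qed.

Lemma sum_nat_lt_le m K : \sum_(1 <= k < m.+1) ((k < K)%N%:R : R) <= K%:R.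
Proof.
rewrite -natr_sum ler_nat; apply: (@leq_trans (\sum_(0 <= k < m.+1) (k < K)%N)).
  by rewrite [leqRHS]big_ltn// leq_addl.
elim: m.+1 => [|l IH]; first by rewrite big_nil.
case: (ltnP l K) => lK.
  rewrite (leq_trans _ lK)// -[l.+1]subn0 -[leqRHS]muln1 -sum_nat_const_nat.
  by apply: leq_sum => k _; case: ltnP.
by rewrite big_nat_recr//= ltnNge lK addn0.
Qed.

Section one_function.
Variables (i j : 'I_n.+1) (M : metricType R) (f : X -> M).
Variables (D r q d : R) (L N : nat) (Z : set X).
Hypotheses (pij : p i = p j) (D0 : 0 < D) (r0 : 0 <= r) (q0 : 0 <= q).
Hypothesis (fD : forall z z', mdist (f z) (f z') <= D).
Hypothesis (fZ : forall z z', ~ Z z -> ~ Z z' -> nearby L d z z' ->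
  mdist (f z) (f z') <= r).
Hypothesis (missN : forall k t, (N <= k)%N -> miss p gam i j d k t <= q).

(** Levels below [L + N] cost at most [D]. At the others the distance is at most [r], except where
    the walk has not stopped [L] generations earlier or one of the two matched points lies in
    [Z]. *)
Let level_distance_le z z' k :
  level_sum p k (fun v => mdist (f (node g v z))
    (f (node g (coupling gam i j d (circle_val z'.2 - circle_val z.2) v) z'))) <=
  (r + D * q) + D * level_sum p k (fun v => \1_Z (node g v z))
  + D * level_sum p k (fun v => \1_Z (node g v z')) + D * (k < L + N)%N%:R.
Proof.
set t := circle_val z'.2 - circle_val z.2; pose A := coupling gam i j d t.
have ind_ge0 z0 : 0 <= level_sum p k (fun v => \1_Z (node g v z0)).
  by rewrite -(level_sum_cst hp k 0); exact: le_level_sum.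
have [kLN|LNk] := ltnP k (L + N).
  apply: (@le_trans _ _ D).
    by rewrite -(level_sum_cst hp k D); apply: le_level_sum.
  rewrite mulr1 lerDr !addr_ge0 ?mulr_ge0 ?(ltW D0)//; exact: ind_ge0.
rewrite mulr0 addr0.
(* The coupling preserves the law of a random node, so the visits of the point matched from [z'] may
   be counted along the coupled node. *)
rewrite -(level_sum_relabel (coupling_ruleK gam i j d t)
  (coupling_rule_prob gam d pij t) k (fun v => \1_Z (node g v z'))) -/A.
have Lk : (L <= k)%N := leq_trans (leq_addr _ _) LNk.
have missE : level_sum p k (fun v =>
    (~~ near_integer d (walk gam i j d t (drop L v)))%:R) <= q.
  rewrite -(subnKC Lk) level_sum_cat.
  apply: (le_trans _ (@missN (k - L) t _)); last by rewrite leq_subRL.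
  apply: le_level_sum => // w _.
  rewrite -[leRHS](level_sum_cst hp L); apply: le_level_sum => // v vL.
  by rewrite drop_size_cat.
apply: (@le_trans _ _ (level_sum p k (fun v => r +
    (D * (~~ near_integer d (walk gam i j d t (drop L v)))%:R +
    (D * \1_Z (node g v z) + D * \1_Z (node g (A v) z')))))).
  apply: le_level_sum => // v vk.
  have [n1|n1] := boolP (near_integer d _); last first.
    apply: (le_trans (fD _ _)); rewrite mulr1 addrCA lerDl.
    by rewrite !addr_ge0 ?mulr_ge0 ?(ltW D0).
  rewrite mulr0 add0r.
  have [z1|z1] := pselect (Z (node g v z)).
    apply: (le_trans (fD _ _)); rewrite indicE mem_set// mulr1 addrCA lerDl.
    by rewrite !addr_ge0 ?mulr_ge0 ?(ltW D0).
  have [z2|z2] := pselect (Z (node g (A v) z')).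
    apply: (le_trans (fD _ _)); rewrite [\1_Z (node g (A v) z')]indicE.
    rewrite (mem_set z2) mulr1 addrA lerDr.
    by rewrite !addr_ge0 ?mulr_ge0 ?(ltW D0).
  apply: le_trans (fZ z1 z2 _) _.
    by apply: close_node_coupling => //; rewrite vk.
  by rewrite lerDl !addr_ge0 ?mulr_ge0 ?(ltW D0).
rewrite !level_sumD !level_sumZ level_sum_cst// -!addrA lerD2l.
by rewrite !addrA !lerD2r ler_wpM2l// ltW.
Qed.

Lemma tbar_le_visits m z z' : (0 < m)%N ->
  tbar p m (fun v => f (node g v z)) (fun v => f (node g v z')) <=
  r + D * q + m%:R^-1 * (D * visits p g m Z z + D * visits p g m Z z' +
                         D * (L + N)%:R).
Proof.
move=> m0; have m0' : 0 < m%:R :> R by rewrite ltr0n.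
apply: (le_trans (tbar_le_automorphism _ _ _
  (relabel_automorphism (coupling_ruleK gam i j d (circle_val z'.2 - circle_val z.2))
    (coupling_rule_prob gam d pij _)))).
have -> : r + D * q = m%:R^-1 * (m%:R * (r + D * q)) by rewrite mulKf ?gt_eqF.
rewrite -mulrDr ler_wpM2l ?invr_ge0//.
apply: (le_trans (ler_sum_nat (fun k _ => level_distance_le z z' k))).
move: (r + D * q) => a.
rewrite !big_split /= -!mulr_sumr sumr_const_nat subn1 -[_ *+ _]mulr_natl.
rewrite -!addrA !lerD2l ler_wpM2l ?(ltW D0)//; exact: sum_nat_lt_le.
Qed.

End one_function.

Lemma tvwB_of_irrational i j : p i = p j -> irrational (gam j - gam i) ->
  tvwB p lam S.
Proof.
move=> pij irr; split; first exact: (skew_shift_preserving hp g hmu).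
exists (@first_symbol R n); split; first exact: (first_symbol_tree_partition hp g hmu).
move=> M f cM mf e e0.
have [D D0 HD] := compact_diameter cM.
(* The final bound has five terms of size at most [r]: the oscillation outside [Z], the misses, the
   visits to [Z] from each of the two points, and the first levels. As [D * c = r], the last four
   are controlled by [c]. *)
pose r := e / 8; have r0 : 0 < r by rewrite divr_gt0.
pose c := r / D; have c0 : 0 < c by rewrite divr_gt0.
have [L [d [Z [d0 mZ Ze HZ]]]] := lusin_fun cM mf r0 (mulr_gt0 c0 e0).
have [N HN] := miss_uniformly_small hp irr d0 c0.
(* From [N0] on, the first [L + N] levels are at most a proportion [c] of all levels. *)
pose N0 := (Num.truncn ((L + N)%:R / c)).+1.
exists N0 => m mN0.
have m0 : (0 < m)%N by exact: leq_trans mN0.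
have m0' : 0 < m%:R :> R by rewrite ltr0n.
have [H [mH He Hv]] := visits_markov hp g hmu mZ c0 m0 Ze.
exists H; split=> // z z' zH zH'.
have tE z0 : tree_name S (@first_symbol R n) f z0 = fun v => f (node g v z0).
  by apply/funext => v; rewrite /tree_name node_branchE.
rewrite !tE.
apply: le_lt_trans (tbar_le_visits pij D0 (ltW r0) (ltW c0) (fun z z' => HD _ _)
  HZ HN z z' m0) _.
have LN : (L + N)%:R <= m%:R * c.
  rewrite -ler_pdivrMr//; apply/ltW/(lt_le_trans (truncnS_gt _)).
  by rewrite ler_nat.
have Dc : D * c = r by rewrite mulrC divfK ?gt_eqF.
apply: (@le_lt_trans _ _ (r + r + (r + r + r))); last by rewrite /r; lra.
rewrite Dc lerD2l ler_pdivrMl// !mulrDr !lerD// -Dc mulrCA ler_wpM2l ?(ltW D0)//;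
  exact: Hv.
Qed.

End sufficiency.

(** * Necessity *)

(* The parameter R selects the field in which the distance takes its values. *)
Definition two_points (R : realType) : Type := bool.

HB.instance Definition _ (R : realType) := Choice.on (two_points R).

Section two_points.
Variable R : realType.

Let dist (a b : two_points R) : R := (a != b)%:R.

Let distxx a : dist a a = 0.
Proof. by rewrite /dist eqxx. Qed.

Let dist_positivity a b : dist a b = 0 -> a = b.
Proof. by rewrite /dist; case: eqP => // _ /eqP; rewrite oner_eq0. Qed.

Let distC a b : dist a b = dist b a.
Proof. by rewrite /dist eq_sym. Qed.

Let dist_triangle b a c : dist a c <= dist a b + dist b c.
Proof. by rewrite /dist -natrD ler_nat; case: a b c => [] [] []. Qed.

HB.instance Definition _ := isMetric.Build R (two_points R)
  distxx dist_positivity distC dist_triangle.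

Lemma two_points_compact : compact [set: two_points R].
Proof. by apply: finite_compact; exact: (@finite_finset bool). Qed.

Lemma two_points_dist (a b : two_points R) : mdist a b = (a != b)%:R.
Proof. by []. Qed.

End two_points.

Section half_circle.
Context {R : realType}.
Implicit Types x y : R.

Definition first_half x : bool := x - (Num.floor x)%:~R < 2^-1.

Lemma first_half_antipode x y : y - x - 2^-1 \is a Num.int ->
  first_half y = ~~ first_half x.
Proof.
move=> /intrP[k kE]; have {kE} -> : y = x + 2^-1 + k%:~R.
  by rewrite -kE; ring.
rewrite /first_half floorDrz ?intr_int// intrKfloor intrD.
rewrite (_ : _ - (_ + _) = x + 2^-1 - (Num.floor (x + 2^-1))%:~R); last by ring.
have /andP[a0 a1] := floor_itv x; rewrite intrD1 in a1.
have [xh|xh] := ltP (x - (Num.floor x)%:~R) 2^-1; last first.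
  have -> : Num.floor (x + 2^-1) = Num.floor x + 1.
    by apply: floor_def; rewrite !intrD1; apply/andP; split; lra.
  by rewrite intrD1 /=; apply/idP; lra.
have -> : Num.floor (x + 2^-1) = Num.floor x.
  by apply: floor_def; rewrite !intrD1; apply/andP; split; lra.
by apply/negbTE; rewrite -leNgt; lra.
Qed.

Lemma measurable_first_half :
  measurable_fun setT (first_half : measurableTypeR R -> bool).
Proof.
apply: measurable_fun_ltr; last exact: measurable_cst.
apply: measurable_funB => //; apply: nondecreasing_measurable => // x y xy.
by rewrite ler_int; exact: le_floor.
Qed.

End half_circle.

(** Comparing the weights of a node and its parent shows that an automorphism replaces each symbol
    by one of equal probability, so each term of the sum changes by an integer. *)
Lemma tree_automorphism_sum {R : realType} {n : nat} (p : 'I_n.+1 -> R)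
    (c : 'I_n.+1 -> R) A :
  positive_prob_vector p -> (forall a b, p a = p b -> c a - c b \is a Num.int) ->
  tree_automorphism p A ->
  forall v, \sum_(a <- v) c a - \sum_(a <- A v) c a \is a Num.int.
Proof.
move=> hp hc [bijA hA].
have inj_neq v : v <> [::] -> A v <> [::].
  move=> v0 Av; have [Ab _] := hA v (introN eqP v0).
  have := bij_inj bijA (etrans Ab (etrans (congr1 behead Av) (esym Av))).
  by case: v v0 {Av Ab} => // a v _ /(congr1 size) /= /n_Sn.
have A0 : A [::] = [::].
  have [B AB BA] := bijA.
  have [B0|/eqP B0] := eqVneq (B [::]) [::]; first by rewrite -[in LHS]B0 BA.
  by have := inj_neq _ B0; rewrite BA.
have wA v : weight p (A v) = weight p v.
  by case: v => [|a v]; [rewrite A0|have [] := hA (a :: v) isT].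
elim=> [|a v IH]; first by rewrite A0 subrr.
have [Ab Aw] := hA (a :: v) isT; have := inj_neq (a :: v).
case E : (A (a :: v)) Ab Aw => [|b w] /= Ab Aw; first by case.
move=> _; rewrite -Ab !big_cons opprD addrACA rpredD//; apply: hc.
move: Aw; rewrite -Ab !weight_cons wA => /esym.
exact: mulIf (lt0r_neq0 (weight_gt0 hp v)) _ _.
Qed.

Lemma negligible_bigcup_countType d (T : measurableType d) (R : realType)
    (mu : {measure set T -> \bar R}) (I : countType) (F : I -> set T) :
  (forall i, mu.-negligible (F i)) -> mu.-negligible (\bigcup_i F i).
Proof.
move=> HF; have -> : \bigcup_i F i =
    \bigcup_k if unpickle k is Some i then F i else set0.
  apply/seteqP; split=> [x [i _ Fi]|x [k _]].
    by exists (pickle i); rewrite ?pickleK.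
  by case: unpickle => // i Fi; exists i.
by apply: negligible_bigcup => k; case: unpickle => [//|]; exact: negligible_set0.
Qed.

Section necessity.
Context {R : realType} {n : nat} (p : 'I_n.+1 -> R) (hp : positive_prob_vector p).
Variables (g : 'I_n.+1 -> circle R) (mu : probability (seqspace n) R).
Hypothesis hmu : is_product_measure p mu.

Local Notation X := (seqspace n * circle R)%type.
Local Notation S := (skew_shift g).
Local Notation lam := (@skew_measure R n mu).
Local Notation gam := (fun a => circle_val (g a)).

Lemma common_denominator :
  (forall i j, p i = p j -> rational (gam j - gam i)) ->
  exists2 q, (0 < q)%N &
    forall i j, p i = p j -> q%:R * gam i - q%:R * gam j \is a Num.int.
Proof.
move=> hrat.
have /choice[b hb] : forall ij : 'I_n.+1 * 'I_n.+1, exists b : nat, (0 < b)%N /\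
    (p ij.1 = p ij.2 -> b%:R * (gam ij.1 - gam ij.2) \is a Num.int).
  move=> [i j] /=; have [pij|pij] := pselect (p i = p j); last by exists 1%N.
  have /rationalP[a [[|b] ->]] := hrat j i (esym pij).
    (* A fraction with denominator 0 has the value 0, an integer. *)
    by exists 1%N; split => // _; rewrite invr0 mulr0 mulr0.
  by exists b.+1; split => // _; rewrite mulrC divfK ?pnatr_eq0// intr_int.
exists (\prod_ij b ij)%N; first by apply: prodn_gt0 => ij; case: (hb ij).
move=> i j pij; rewrite -mulrBr (bigD1 (i, j))//= mulnC natrM -mulrA.
rewrite rpredM//; first by rewrite natr_int.
by have [_] := hb (i, j); apply.
Qed.

Definition turn t (z : X) : X := (z.1, rotation t z.2).

Lemma measurable_turn t : measurable_fun setT (turn t).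
Proof.
apply: measurable_fun_pair; first exact: measurable_fst.
exact: measurableT_comp (measurable_rotation _) measurable_snd.
Qed.

Lemma turn_preserving t (B : set X) : measurable B -> lam (turn t @^-1` B) = lam B.
Proof.
move=> mB; pose m := pushforward lam (turn t).
apply/esym.
apply: (@product_measure_unique _ _ _ _ _ mu (circle_lebesgue R) m) => //.
  exact: measurable_turn.
move=> mt C D mC mD.
have mrD := measurable_preimageT (measurable_rotation t) mD.
transitivity (lam (C `*` (rotation t @^-1` D))) => //.
rewrite [LHS](@product_measure1E _ _ _ _ _ mu)//.
by rewrite [X in (_ * X)%E](circle_lebesgue_rotation _ mD).
Qed.

(** Since [p j] is positive, [branch_prob] shows that pulling back along a branch keeps null sets
    null. *)
Lemma node_null v (B : set X) : measurable B -> lam B = 0%E ->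
  lam (node g v @^-1` B) = 0%E.
Proof.
elim: v B => // j v IH B mB B0.
have mb := measurable_preimageT (measurable_branch g j) mB.
apply: (IH (branch g j @^-1` B)) => //.
have pj : ((p j)%:E * lam (branch g j @^-1` B) = 0)%E.
  rewrite (branch_prob hp g hmu)//; apply/eqP; rewrite -measure_le0 -B0.
  apply: le_measure; rewrite ?inE//; apply: measurableI => //.
  exact: measurable_first_symbol.
move/eqP: pj; rewrite mule_eq0 => /orP[|/eqP//].
by rewrite eqe gt_eqF// hp.1.
Qed.

(** * Names read through an arbitrary tree partition *)

Section arbitrary_partition.
Variable K : X -> 'I_n.+1.
Hypothesis hK : tree_partition p lam S K.

(* The base points of fibres whose point with first symbol i has K-value j.  On
   this set both p_i and p_j are the conditional probability of that point, so
   it is null unless p_i = p_j. *)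
Let class_mismatch i j : set X := branch g i @^-1` (K @^-1` [set j]).

Let measurable_class_mismatch i j : measurable (class_mismatch i j).
Proof.
have [mK _ _] := hK.
exact: measurable_preimageT (measurable_branch g i) (mK j).
Qed.

Let class_mismatch_null i j : p i <> p j -> lam (class_mismatch i j) = 0%E.
Proof.
move=> pij; have [mK [N [mN N0 HN]] fK] := hK.
set D := class_mismatch i j; have mD : measurable D := measurable_class_mismatch i j.
have mS := measurable_skew_shift g.
have E1 : (lam (K @^-1` [set j] `&` S @^-1` D) = (p j)%:E * lam D)%E.
  have [_ /(_ _ mD) ->] := fK j; exact: (@integral_cst _ _ _ lam _ mD (p j)%:E).
have E2 := fiber_prob hp g hmu i mD.
have mSD := measurable_preimageT mS mD.
have mSN := measurable_preimageT mS mN.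
have mi := measurable_first_symbol (R := R) i.
have mKj := mK j.
have E3 : lam (K @^-1` [set j] `&` S @^-1` D) =
          lam ([set z | first_symbol z = i] `&` S @^-1` D).
  apply/eqP; rewrite eq_le; apply/andP; split; last first.
    apply: le_measure; rewrite ?inE; [exact: measurableI..|].
    move=> z [/= zi Dz]; split => //; move: Dz.
    by rewrite /D /class_mismatch /= -zi branch_skew_shift.
  have : (lam (S @^-1` N) = 0)%E.
    by rewrite (skew_shift_preserving hp g hmu).2.
  rewrite -[leRHS]adde0 => <-.
  apply: (@le_trans _ _ (lam
    (([set z | first_symbol z = i] `&` S @^-1` D) `|` S @^-1` N))).
    apply: le_measure; rewrite ?inE; [exact: measurableI| |].
      by apply: measurableU => //; exact: measurableI.
    move=> z [/= zj Dz]; have [zN|zN] := pselect (N (S z)); first by right.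
    left; split => //=.
    have : forall j0, exists! y, S y = S z /\ K y = j0.
      by apply: contrapT => /HN.
    move=> /(_ j)[y [_ y_uniq]].
    rewrite -(y_uniq z (conj erefl zj)).
    by rewrite (y_uniq _ (conj (branchK g i (S z)) Dz)).
  by apply: measureU2 => //; exact: measurableI.
move: E3; rewrite E1 E2 -(fineK (fin_num_measure lam D mD)) -!EFinM => -[].
move/eqP; rewrite -subr_eq0 -mulrBl mulf_eq0 subr_eq0 => /orP[/eqP/esym//|/eqP ->//].
Qed.

(** There are countably many nodes, so the pullbacks along all of them of the null sets where [K]
    misbehaves still form a null set. *)
Lemma tree_partition_regular_set : exists W : set X,
  [/\ measurable W, lam W = 0%E & forall z, ~ W z -> forall v,
     let y := node g v z in
     (forall j, exists y', S y' = y /\ K y' = j) /\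
     (forall i j, K (branch g i y) = j -> p i = p j)].
Proof.
have [mK [N [mN N0 HN]] fK] := hK.
have [M [mM M0 HM]] : lam.-negligible (\bigcup_(ij : 'I_n.+1 * 'I_n.+1)
    if `[< p ij.1 <> p ij.2 >] then class_mismatch ij.1 ij.2 else set0).
  apply: negligible_bigcup_countType => -[i j] /=.
  case: asboolP => [pij|_]; last exact: negligible_set0.
  by exists (class_mismatch i j); split => //; exact: class_mismatch_null.
have [W [mW W0 HW]] : lam.-negligible (\bigcup_v node g v @^-1` (N `|` M)).
  apply: negligible_bigcup_countType => v.
  exists (node g v @^-1` (N `|` M)); split => //.
    exact: measurable_preimageT (measurable_node g v) (measurableU _ _ mN mM).
  apply: node_null; first exact: measurableU.
  have : (lam N + lam M = 0)%E by rewrite N0 M0 adde0.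
  move=> NM0; apply/eqP; rewrite -measure_le0 -NM0; exact: measureU2.
exists W; split=> // z zW v y.
have yNM : ~ (N `|` M) y.
  by move=> yNM; apply: zW; apply: HW; exists v.
split=> [j|i j Kij].
  have : forall j0, exists! y', S y' = y /\ K y' = j0.
    by apply: contrapT => H; apply: yNM; left; apply: HN.
  by move=> /(_ j)[y' [? _]]; exists y'.
apply: contrapT => pij; apply: yNM; right; apply: HM.
by exists (i, j) => //=; rewrite asboolT.
Qed.

End arbitrary_partition.

(** Symbol by symbol, the K-name [v] of a point is exchanged for its true name [w], with symbols of
    equal probability; after multiplication by [q] this does not alter the angle modulo 1. *)
Lemma node_branch_angle K q z :
  (forall v, let y := node g v z in
     (forall j, exists y', S y' = y /\ K y' = j) /\
     (forall i j, K (branch g i y) = j -> p i = p j)) ->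
  (forall i j, p i = p j -> q%:R * gam i - q%:R * gam j \is a Num.int) ->
  forall v, q%:R * circle_val (node_branch S K v z).2 -
    (q%:R * circle_val z.2 - \sum_(a <- v) q%:R * gam a) \is a Num.int.
Proof.
move=> hz hq v.
have [w [-> hw]] : exists w, node_branch S K v z = node g w z /\
    \sum_(a <- v) q%:R * gam a - \sum_(a <- w) q%:R * gam a \is a Num.int.
  elim: v => [|j v [w [IH hw]]]; first by exists [::]; rewrite subrr.
  have [/(_ j)[y' [y'1 y'2]] hp'] := hz w.
  rewrite /= -/(node_branch S K v z) IH.
  have [y [yw yj]] : exists y, preimage_branch S K j (node g w z) = y /\
      (S y = node g w z /\ K y = j).
    eexists; split; first reflexivity.
    by rewrite /preimage_branch; case: xgetP => [y _ //|/(_ y')[]].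
  have yE : branch g (first_symbol y) (node g w z) = y.
    by case: yj => <- _; rewrite branch_skew_shift.
  exists (first_symbol y :: w); split; first by rewrite /= yw yE.
  rewrite !big_cons opprD addrACA rpredD//; apply/hq/esym/hp'.
  by rewrite yE; case: yj.
have [k ->] := node_angle g w z.
have -> : q%:R * (circle_val z.2 - \sum_(a <- w) gam a + k%:~R) -
  (q%:R * circle_val z.2 - \sum_(a <- v) q%:R * gam a) =
  (\sum_(a <- v) q%:R * gam a - \sum_(a <- w) q%:R * gam a) + q%:R * k%:~R.
  by rewrite -[\sum_(a <- w) q%:R * gam a]mulr_sumr; ring.
by rewrite rpredD// rpredM ?natr_int ?intr_int.
Qed.

Lemma not_tvwB_of_rational :
  (forall i j, p i = p j -> rational (gam j - gam i)) -> ~ tvwB p lam S.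
Proof.
move=> hrat [_ [K [hK tK]]].
have [q q0 hq] := common_denominator hrat.
have q0' : q%:R != 0 :> R by rewrite pnatr_eq0 -lt0n.
pose f (z : X) : two_points R := first_half (q%:R * circle_val z.2).
have mf : borel_measurable f.
  move=> U _.
  have mg : measurable_fun setT (fun z : X => first_half (q%:R * circle_val z.2)).
    apply: measurableT_comp measurable_first_half _.
    apply: measurable_funM; first exact: measurable_cst.
    apply: measurableT_comp (@measurable_snd _ _ (seqspace n) (circle R)).
    by move=> _ B mB; exists B.
  exact: (measurable_preimageT mg (I : measurable (U : set bool))).
have e0 : 0 < 4^-1 :> R by [].
have [N HN] := tK _ f (@two_points_compact R) mf _ e0.
(* The depth [N.+1] is positive, so the average over levels can be cleared of its denominator. *)
have [H [mH He Hd]] := HN N.+1 (leqnSn N).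
have [W [mW W0 HW]] := tree_partition_regular_set hK.
(* Half a period of [f], as [q * t = 1/2]. *)
pose t : R := (2 * q%:R)^-1.
have [z [zH zW zH' zW']] : exists z, [/\ H z, ~ W z, H (turn t z) & ~ W (turn t z)].
  (* Both [A] and its preimage under [turn t] have measure at least [3/4], so they meet. *)
  apply: contrapT => none; pose A := H `\` W.
  have mA : measurable A by exact: measurableD.
  have mtA := measurable_preimageT (measurable_turn t) mA.
  have A34 : ((1 - 4^-1)%:E <= lam A)%E.
    apply: (le_trans He); rewrite -[leRHS]adde0 -W0.
    apply: (@le_trans _ _ (lam (A `|` W))); last exact: measureU2.
    apply: le_measure; rewrite ?inE//; first exact: measurableU.
    by move=> z Hz; have [|Wz] := pselect (W z); [right|left].
  have : (lam (A `|` turn t @^-1` A) <= 1)%E.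
    by apply: probability_le1; exact: measurableU.
  rewrite measureU//; last first.
    rewrite -subset0 => z [[Hz Wz] [Hz' Wz']]; apply: none.
    by exists z.
  apply/negP; rewrite -ltNge.
  apply: (@lt_le_trans _ _ ((1 - 4^-1)%:E + (1 - 4^-1)%:E)%E).
    by rewrite -EFinD lte_fin; lra.
  apply: leeD => //; apply: le_trans A34 _.
  by rewrite [leRHS](turn_preserving t mA).
have := Hd _ _ zH zH'; apply/negP; rewrite -leNgt.
apply: (@le_trans _ _ 1); first lra.
rewrite /tbar ler_pdivlMl ?mulr1//.
apply: lb_le_inf.
  exists (\sum_(1 <= k < N.+2) \sum_(v : k.-tuple 'I_n.+1) weight p v *
    mdist (tree_name S K f z v)
      (tree_name S K f (turn t z) v)), id => //.
  by split => //; exists id.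
move=> _ [A hA <-].
have fA v : mdist (tree_name S K f z v)
    (tree_name S K f (turn t z) (A v)) = 1 :> R.
  rewrite two_points_dist /tree_name /f.
  rewrite (@first_half_antipode _ (q%:R * circle_val (node_branch S K v z).2)
    (q%:R * circle_val (node_branch S K (A v) (turn t z)).2)).
    by case: first_half.
  have h1 := node_branch_angle (HW z zW) hq v.
  have h2 := node_branch_angle (HW _ zW') hq (A v).
  have h3 := tree_automorphism_sum hp hq hA v.
  have [k kE] : exists k : int, circle_val (turn t z).2 = circle_val z.2 + t + k%:~R.
    exact: rotation_val.
  rewrite kE in h2.
  set a := circle_val _ in h2 *; set b := circle_val _ in h1 *.
  (* The bracketed differences are the integers of [h2], [h1] and [h3]; the term [q * t] accounts
     for [1/2]. *)
  have -> : q%:R * a - q%:R * b - 2^-1 =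
    (q%:R * a - (q%:R * (circle_val z.2 + t + k%:~R) -
      \sum_(a <- A v) q%:R * gam a)) -
    (q%:R * b - (q%:R * circle_val z.2 - \sum_(a <- v) q%:R * gam a)) +
    (\sum_(a <- v) q%:R * gam a - \sum_(a <- A v) q%:R * gam a) + q%:R * k%:~R.
    have -> : 2^-1 = q%:R * t by rewrite /t; field.
    by ring.
  apply: rpredD; last by rewrite rpredM ?natr_int ?intr_int.
  by apply: rpredD => //; exact: rpredB.
have -> : N.+1%:R = \sum_(1 <= k < N.+2) level_sum p k (fun=> 1) :> R.
  by under eq_bigr do rewrite level_sum_cst//; rewrite sumr_const_nat subn1.
by apply: ler_sum => k _; apply: ler_sum => v _; rewrite fA.
Qed.

End necessity.

Theorem proposition4p2p2 (R : realType) (n : nat) (p : 'I_n.+1 -> R)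
    (hp : positive_prob_vector p) (g : 'I_n.+1 -> circle R)
    (mu : probability (seqspace n) R) (hmu : is_product_measure p mu) :
  tvwB p (mu \x circle_lebesgue R)%E (skew_shift g) <->
  exists i j : 'I_n.+1,
    [/\ i <> j, p i = p j & irrational (circle_val (g j) - circle_val (g i))].
Proof.
split=> [tv|[i [j [_ pij irr]]]]; last exact: (tvwB_of_irrational hp hmu pij irr).
apply: contrapT => none; apply: (not_tvwB_of_rational hp hmu _ tv) => i j pij.
apply: contrapT => irr; apply: none; exists i, j; split => // ij.
by apply: irr; rewrite ij subrr; exists 0; rewrite // rmorph0.
Qed.
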